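(* Let $1\le p\le q<\infty$, $\alpha>-1$ and $0\le\gamma<2+\alpha$. Let $\omega$ be a weight and $\mu$ a positive Borel measure on $\mathcal H$. The following are equivalent: (a) there is $C_1>0$ such that for every $f\in L^p(\mathcal H,\omega\,dV_\alpha)$ and every $\lambda>0$, $$\mu(\{z\in\mathcal H:\mathcal M_{\alpha,\gamma}f(z)>\lambda\})\le\frac{C_1}{\lambda^q}\left(\int_{\mathcal H}|f|^p\omega\,dV_\alpha\right)^{q/p};$$ (b) there is $C_2>0$ such that for every interval $I\subset\mathbb R$, $$|Q_I|_\alpha^{q(\frac{\gamma}{2+\alpha}-\frac1p)}\left(\frac1{|Q_I|_\alpha}\int_{Q_I}\omega^{1-p'}\,dV_\alpha\right)^{q/p'}\mu(Q_I)\le C_2,$$ where for $p=1$ the factor $\left(\frac1{|Q_I|_\alpha}\int_{Q_I}\omega^{1-p'}dV_\alpha\right)^{1/p'}$ is understood as $(\inf_{Q_I}\omega)^{-1}$; (c) there is $C_3>0$ such that for every locally integrable $f$ and every interval $I\subset\mathbb R$, $$\left(\frac{1}{|Q_I|_\alpha^{1-\frac{\gamma}{2+\alpha}}}\int_{Q_I}|f|\,dV_\alpha\right)^q\mu(Q_I)\le C_3\left(\int_{Q_I}|f|^p\omega\,dV_\alpha\right)^{q/p}.$$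
   Context: $\mathcal H=\{x+iy:x\in\mathbb R,\ y>0\}$; for $\alpha>-1$, $dV_\alpha(x+iy)=y^\alpha dx\,dy$. A weight is a nonnegative locally integrable function on $\mathcal H$; $L^p(\mathcal H,\omega dV_\alpha)$ is the space of $f$ with $\int_{\mathcal H}|f|^p\omega\,dV_\alpha<\infty$. $p'$ is the conjugate exponent of $p$. For an interval $I\subset\mathbb R$, $Q_I=\{x+iy:x\in I,\ 0<y<|I|\}$ and $|Q_I|_\alpha=\int_{Q_I}dV_\alpha$. For $0\le\gamma<2+\alpha$ and locally integrable $f$, $\mathcal M_{\alpha,\gamma}f(z)=\sup\{|I|^{-(2+\alpha-\gamma)}\int_{Q_I}|f|\,dV_\alpha:\ I\subset\mathbb R\text{ an interval with } z\in Q_I\}$.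
   Formalization: For p=1 the infimum of ω over Q_I in (b) is taken as the essential infimum; with the pointwise infimum the equivalence fails, e.g. p=q=1, α=γ=0, μ Lebesgue, ω=1 except ω(i)=0. *)

(* Defs.v *)
From HB Require Import structures.
From mathcomp Require Import all_boot all_order all_algebra.
From mathcomp Require Import all_classical all_reals all_analysis.
Set Implicit Arguments. Unset Strict Implicit. Unset Printing Implicit Defensive.
Import Order.TTheory GRing.Theory Num.Theory.
Import numFieldNormedType.Exports.
Local Open Scope classical_set_scope.
Local Open Scope ring_scope.

Section Defs.
Variable R : realType.

Definition leb2 := (@lebesgue_measure R \x @lebesgue_measure R)%E.

Definition Hplane : set (R * R) := [set z | 0 < z.2].

Definition epow (x : \bar R) (r : R) : \bar R :=
  match x with
  | +oo%E => if 0 < r then +oo%E else if r < 0 then 0%E else 1%E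
  | -oo%E => 0%E
  | EFin a => if 0 < a then (a `^ r)%:E
              else if a == 0 then
                (if 0 < r then 0%E else if r < 0 then +oo%E else 1%E)
              else 0%E
  end.

(* integral over A of g with respect to dV_alpha(x+iy) = y^alpha dx dy *)
Definition intV (alpha : R) (A : set (R * R)) (g : R * R -> \bar R) : \bar R :=
  (\int[leb2]_(z in A) (g z * (z.2 `^ alpha)%:E))%E.

Definition Vol (alpha : R) (A : set (R * R)) : \bar R :=
  intV alpha A (fun=> 1%E).

(* I is a bounded interval of R with endpoints a < b (open, closed or
   half-open); its length is |I| = b - a *)
Definition interval_ab (I : set R) (a b : R) : Prop :=
  a < b /\ `]a, b[ `<=` I /\ I `<=` `[a, b].

(* Q_I = { x + i y : x in I, 0 < y < |I| } with |I| = len *)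
Definition QI (I : set R) (len : R) : set (R * R) :=
  [set z | I z.1 /\ 0 < z.2 /\ z.2 < len].

Definition Mfrac (alpha gamma : R) (f : R * R -> R) (z : R * R) : \bar R :=
  ereal_sup [set v : \bar R | exists I a b, interval_ab I a b /\
     QI I (b - a) z /\
     v = (((b - a) `^ (- (2 + alpha - gamma)))%:E *
          intV alpha (QI I (b - a)) (fun w => `|f w|%:E))%E].

Definition loc_integrable_H (f : R * R -> R) : Prop :=
  measurable_fun Hplane f /\
  forall K, K `<=` Hplane -> compact K ->
    (\int[leb2]_(z in K) `|f z|%:E < +oo)%E.

Definition weight (w : R * R -> R) : Prop :=
  (forall z, Hplane z -> 0 <= w z) /\ loc_integrable_H w.

(* essential infimum of w on A (w.r.t. Lebesgue measure, equivalently dV_alpha) *)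
Definition essinf_on (A : set (R * R)) (w : R * R -> R) : \bar R :=
  ereal_sup [set c : \bar R | leb2 (A `&` [set z | ((w z)%:E < c)%E]) = 0%E].

End Defs.

(* Main.v *)
(** Write N = 2 + alpha, so that |Q_I|_alpha = |I|^N / (1 + alpha).

    (b) implies a box inequality: for every measurable E in Q_I,
    (|I|^(gamma - N) \int_E |f|)^q mu(Q_I) <= K (\int_E |f|^p w)^(q/p).
    For p > 1 one integrates the elementary bound
    |f| <= s w |f|^p + (s w)^(1 - p'), valid for every s > 0 and also where
    w = 0, and optimises s; for p = 1 one compares w with half its essential
    infimum.  Taking E = Q_I gives (c).

    For (a), the superlevel set of the maximal function is a countable union of
    boxes over intervals with rational endpoints.  From finitely many of these
    intervals Vitali's lemma selects disjoint J with the boxes over 3J covering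
    the original ones; the box inequality on Q_{3J} with E = Q_J bounds
    mu(Q_{3J}), and q/p >= 1 makes the right-hand sides superadditive.

    Conversely (a) and (c) each give the box inequality with E = Q_I for bounded
    functions f supported in Q_I.  The choice f = min(w^(1 - p'), n), for which
    |f|^p w <= f, or f = 1_{w < t} when p = 1, yields (b). *)

Require Import Defs.
From HB Require Import structures.
From mathcomp Require Import all_boot all_order all_algebra.
From mathcomp Require Import all_classical all_reals all_analysis.
From mathcomp Require Import measurable_realfun ring lra.
Import Order.TTheory GRing.Theory Num.Theory.
Import numFieldNormedType.Exports.
Local Open Scope classical_set_scope.
Local Open Scope ring_scope.
Local Set Implicit Arguments.
Local Unset Strict Implicit.
Local Unset Printing Implicit Defensive.

(* The sigma-algebra of [leb2]; it is convertible to the one carrying [mu] on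
   [R * R], but with a different measurable display, so the measurability of
   sets and functions is stated on [plane R] throughout. *)
Notation plane R := (measurableTypeR R * measurableTypeR R)%type.

(** The constant [leb2] hides the product structure; the copy lets inference find a measure on
    it. *)
HB.instance Definition _ (R : realType) :=
  Measure.copy (@leb2 R) (@lebesgue_measure R \x @lebesgue_measure R)%E.

(** * Powers of extended nonnegative numbers *)

Section Epow.
Context {R : realType}.
Implicit Types (x y : \bar R) (a r : R).

Lemma epow_ge0 x r : (0 <= epow x r)%E.
Proof.
case: x => [a| |] //=.
- case: ifPn => [a0|_]; first by rewrite lee_fin powR_ge0.
  by case: ifPn => // _; case: ifPn => // _; case: ifPn.
- by case: ifPn => // _; case: ifPn.
Qed.

Lemma epow_pos a r : 0 < a -> epow a%:E r = (a `^ r)%:E.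
Proof. by move=> a0 /=; rewrite a0. Qed.

Lemma epow_fin a r : 0 <= a -> 0 < r -> epow a%:E r = (a `^ r)%:E.
Proof.
rewrite le0r => /orP[/eqP -> r0|a0 r0]; last by rewrite epow_pos.
by rewrite /= ltxx eqxx r0 powR0 // gt_eqF.
Qed.

Lemma epow0_neg r : r < 0 -> epow 0%:E r = +oo%E.
Proof. by move=> r0 /=; rewrite ltxx eqxx r0 ltNge ltW. Qed.

Lemma epow_pinfty r : 0 < r -> epow +oo%E r = +oo%E.
Proof. by move=> /= ->. Qed.

Lemma epow_gt0 x r : (0 < x)%E -> (x < +oo)%E -> (0 < epow x r)%E.
Proof.
by case: x => [a| |] // a0 _; rewrite epow_pos // lte_fin powR_gt0.
Qed.

Lemma le_epow x y r : 0 < r -> (0 <= x)%E -> (x <= y)%E ->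
  (epow x r <= epow y r)%E.
Proof.
move=> r0; case: y => [b| |] x0 xy; last 2 first.
- by rewrite epow_pinfty // leey.
- by move: (le_trans x0 xy).
case: x x0 xy => [a| |] //; rewrite !lee_fin => a0 ab.
rewrite !epow_fin ?lee_fin ?(le_trans a0) //.
by apply: (ge0_ler_powR (ltW r0)) => //; rewrite nnegrE // (le_trans a0).
Qed.

End Epow.

(** * Integration against y^alpha dx dy *)

Section WeightedIntegral.
Context {R : realType} (al : R).
Implicit Types (A B : set (plane R)) (f g : plane R -> \bar R).

Lemma measurable_yweight A f : measurable_fun A f ->
  measurable_fun A (fun z => (f z * (z.2 `^ al)%:E)%E).
Proof.
move=> mf; apply: emeasurable_funM => //; apply/measurable_EFinP.
apply: (@measurable_comp _ _ _ _ _ _ setT (fun y => y `^ al) A snd) => //.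
by apply: measurable_funTS; exact: measurable_snd.
Qed.

Lemma intV_ge0 A f : (forall z, A z -> (0 <= f z)%E) -> (0 <= intV al A f)%E.
Proof.
move=> f0; apply: integral_ge0 => z Az.
by rewrite mule_ge0 ?f0 // lee_fin powR_ge0.
Qed.

Lemma eq_intV A f g : (forall z, A z -> f z = g z) -> intV al A f = intV al A g.
Proof. by move=> fg; apply: eq_integral => z /[!inE] Az; rewrite fg. Qed.

Lemma le_intV A f g : measurable A -> measurable_fun A f -> measurable_fun A g ->
  (forall z, A z -> (0 <= f z)%E) -> (forall z, A z -> (f z <= g z)%E) ->
  (intV al A f <= intV al A g)%E.
Proof.
move=> mA mf mg f0 fg; rewrite /intV; apply: ge0_le_integral => //.
- by move=> z Az; rewrite mule_ge0 ?f0 // lee_fin powR_ge0.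
- exact: measurable_yweight.
- exact: measurable_yweight.
- by move=> z Az; rewrite lee_wpmul2r ?fg // lee_fin powR_ge0.
Qed.

Lemma subset_intV A B f : measurable A -> measurable B -> measurable_fun B f ->
  (forall z, B z -> (0 <= f z)%E) -> A `<=` B -> (intV al A f <= intV al B f)%E.
Proof.
move=> mA mB mf f0 AB; apply: ge0_subset_integral => //.
- exact: measurable_yweight.
- by move=> z Az; rewrite mule_ge0 ?f0 // lee_fin powR_ge0.
Qed.

Lemma intVZ A f (k : R) : measurable A -> measurable_fun A f ->
  (forall z, A z -> (0 <= f z)%E) -> 0 <= k ->
  intV al A (fun z => k%:E * f z)%E = (k%:E * intV al A f)%E.
Proof.
move=> mA mf f0 k0; rewrite /intV -ge0_integralZl //.
- by apply: eq_integral => z _; rewrite muleA.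
- exact: measurable_yweight.
- by move=> z Az; rewrite mule_ge0 ?f0 // lee_fin powR_ge0.
Qed.

Lemma intVD A f g : measurable A -> measurable_fun A f -> measurable_fun A g ->
  (forall z, A z -> (0 <= f z)%E) -> (forall z, A z -> (0 <= g z)%E) ->
  intV al A (fun z => f z + g z)%E = (intV al A f + intV al A g)%E.
Proof.
move=> mA mf mg f0 g0; rewrite /intV -ge0_integralD //.
- apply: eq_integral => z /[!inE] Az; rewrite ge0_muleDl ?f0 ?g0 //.
- by move=> z Az; rewrite mule_ge0 ?f0 // lee_fin powR_ge0.
- exact: measurable_yweight.
- by move=> z Az; rewrite mule_ge0 ?g0 // lee_fin powR_ge0.
- exact: measurable_yweight.
Qed.

Lemma intV_setU A B f : measurable A -> measurable B ->
  measurable_fun (A `|` B) f -> (forall z, (A `|` B) z -> (0 <= f z)%E) ->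
  A `&` B = set0 ->
  intV al (A `|` B) f = (intV al A f + intV al B f)%E.
Proof.
move=> mA mB mf f0 AB; rewrite /intV ge0_integral_setU //.
- exact: measurable_yweight.
- by move=> z Az; rewrite mule_ge0 ?f0 // lee_fin powR_ge0.
- by apply/disj_setPS; rewrite AB.
Qed.

(** In the half-plane the density y^al is positive, so a vanishing integral would confine [A], where
    [f] is positive, to a null set. *)
Lemma intV_gt0 A f : measurable A -> A `<=` @Hplane R -> (0 < leb2 A)%E ->
  measurable_fun A f -> (forall z, A z -> (0 < f z)%E) -> (0 < intV al A f)%E.
Proof.
move=> mA AH A0 mf f0; rewrite lt0e intV_ge0 ?andbT; last by move=> z /f0/ltW.
apply/eqP => int0.
have pos z : A z -> (0 < f z * (z.2 `^ al)%:E)%E.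
  by move=> Az; rewrite mule_gt0 ?f0 // lte_fin powR_gt0 //; exact: AH.
have : (\int[@leb2 R]_(z in A) `|f z * (z.2 `^ al)%:E|%E = 0)%E.
  rewrite -[RHS]int0; apply: eq_integral => z /[!inE] Az.
  by rewrite gee0_abs // ltW // pos.
move/(ae_eq_integral_abs (@leb2 R) mA (measurable_yweight mf)).
case=> N [mN N0 AN]; suff : (leb2 A <= leb2 N)%E by rewrite N0 leNgt A0.
apply: le_measure; rewrite ?inE //; apply: subset_trans AN => z Az /= /(_ Az) h.
by have := pos z Az; rewrite h ltxx.
Qed.

End WeightedIntegral.

(** * Boxes over intervals *)

Section Boxes.
Context {R : realType}.
Implicit Types (I : set R) (a b x y : R).

Lemma interval_ab_itv I a b : interval_ab I a b ->
  exists bl br : bool, I = [set` Interval (BSide bl a) (BSide br b)].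
Proof.
move=> [ab [sI Is]]; pose bl := `[< I a >]; pose br := `[< ~ I b >].
(* [BSide true] is a closed bound on the left but an open one on the right, hence the negation. *)
exists bl, (~~ `[< I b >]); rewrite /bl; apply/seteqP; split => x /=.
  move=> Ix; have := Is _ Ix; rewrite /= !in_itv /= => /andP[ax xb].
  apply/andP; split.
    case: (asboolP (I a)) => Ia //=; rewrite lt_neqAle ax andbT.
    by apply/eqP => e; apply: Ia; rewrite e.
  case: (asboolP (I b)) => Ib //=; rewrite lt_neqAle xb andbT.
  by apply/eqP => e; apply: Ib; rewrite -e.
rewrite in_itv /= => /andP[ax xb].
have [e|xa] := eqVneq x a.
  by move: ax; case: (asboolP (I a)) => Ia /=; rewrite e // ltxx.
have [e|xb'] := eqVneq x b.
  by move: xb; case: (asboolP (I b)) => Ib /=; rewrite e // ltxx.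
apply: sI; rewrite /= in_itv /=; apply/andP; split.
  by rewrite lt_neqAle eq_sym xa; case: `[< I a >] ax => //= /ltW.
by rewrite lt_neqAle xb'; case: `[< I b >] xb => //= /ltW.
Qed.

Lemma interval_ab_measurable I a b : interval_ab I a b ->
  measurable (I : set (measurableTypeR R)).
Proof. by move=> /interval_ab_itv[bl [br ->]]; exact: measurable_itv. Qed.

Lemma lebesgue_interval_ab I a b : interval_ab I a b ->
  lebesgue_measure (I : set (measurableTypeR R)) = (b - a)%:E.
Proof.
move=> Iab; have [ab _] := Iab; have [bl [br ->]] := interval_ab_itv Iab.
by rewrite lebesgue_measure_itv /= lte_fin ab -EFinD.
Qed.

Lemma QIE I (l : R) : QI I l = I `*` `]0, l[%classic.
Proof.
by apply/seteqP; split => -[x y] /=; rewrite /QI/= in_itv /= => -[? /andP].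
Qed.

Lemma measurable_QI I a b (l : R) : interval_ab I a b ->
  measurable (QI I l : set (plane R)).
Proof.
move=> Iab; rewrite QIE; apply: measurableX; last exact: measurable_itv.
exact: interval_ab_measurable Iab.
Qed.

Lemma leb2_QI I a b : interval_ab I a b ->
  leb2 (QI I (b - a)) = ((b - a) ^+ 2)%:E.
Proof.
move=> Iab; have [ab _] := Iab.
rewrite QIE; apply: etrans.
  by apply: (@product_measure1E _ _ _ _ _ (@lebesgue_measure R) (@lebesgue_measure R));
    [exact: interval_ab_measurable Iab|exact: measurable_itv].
rewrite /= (lebesgue_interval_ab Iab) lebesgue_measure_itv /= lte_fin subr_gt0 ab.
by rewrite -EFinB subr0 -EFinM expr2.
Qed.

Lemma QI_Hplane I (l : R) : QI I l `<=` @Hplane R.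
Proof. by move=> z [_ []]. Qed.

Lemma measurable_Hplane : measurable (@Hplane R : set (plane R)).
Proof.
have -> : @Hplane R = setT `*` `]0, +oo[%classic.
  by apply/seteqP; split => -[x y] /=; rewrite /Hplane /= in_itv /= andbT // => -[].
by apply: measurableX => //; exact: measurable_itv.
Qed.

End Boxes.

(** * Volume of a box *)

Section Volume.
Context {R : realType}.
Implicit Types (al l a b y : R) (I : set R).

(** For negative [al] the integrand blows up at 0, so the fundamental theorem of calculus is applied
    on [u n, l] with [u n] decreasing to 0. These intervals exhaust the domain, and al + 1 > 0 makes
    the boundary term at [u n] vanish in the limit. *)
Lemma integral_powR_itvoo al l : -1 < al -> 0 < l ->
  (\int[lebesgue_measure]_(y in `]0%R, l[) (y `^ al)%:E)%E =
    (l `^ (al + 1) / (al + 1))%:E.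
Proof.
move=> al1 l0; have be0 : 0 < al + 1 by lra.
(* The index shift gives u 0 = l / 2, so that every [u n] lies strictly below [l]. *)
pose u (n : nat) : R := l * harmonic n.+1.
have u0 n : 0 < u n by rewrite /u mulr_gt0 // /harmonic /= invr_gt0.
have ul n : u n < l.
  by rewrite /u gtr_pMr // /= invf_lt1 // ltr1n.
have u_cvg : u n @[n --> \oo] --> 0.
  rewrite -(mulr0 l); apply: cvgMr.
  by rewrite (cvg_shiftS (@harmonic R)); exact: cvg_harmonic.
have mpow D : measurable_fun D (fun y : measurableTypeR R => (y `^ al)%:E).
  by apply/measurable_EFinP; apply: measurable_funTS; exact: measurable_powR.
rewrite (@integral_itv_bndo_bndc _ (BRight 0) l (fun y => (y `^ al)%:E)); last first.
  exact: mpow.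
have -> : `]0, l]%classic = \bigcup_n `[u n, l]%classic.
  apply/seteqP; split => y /=.
    rewrite in_itv /= => /andP[y0 yl].
    have /cvgrPdist_lt/(_ y y0)[N _ /(_ N (leqnn N))] := u_cvg.
    rewrite /= sub0r normrN gtr0_norm // => uy.
    by exists N => //=; rewrite in_itv /= yl ltW.
  by case=> n _ /=; rewrite !in_itv /= => /andP[uy ->]; rewrite (lt_le_trans (u0 n)).
have : ((\int[lebesgue_measure]_(y in `[u n, l]) (y `^ al)%:E)%E @[n --> \oo] -->
   (\int[lebesgue_measure]_(y in \bigcup_n `[u n, l]%classic) (y `^ al)%:E)%E).
  apply: ge0_nondecreasing_set_cvg_integral.
  - move=> m n mn; apply/subsetPset => y /=; rewrite !in_itv /= => /andP[uy ->].
    rewrite andbT; apply: le_trans uy; rewrite /u ler_pM2l //.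
    by rewrite /harmonic /= lef_pV2 ?posrE // ler_nat.
  - by move=> n; exact: measurable_itv.
  - by move=> n; exact: mpow.
  - by move=> n y _; rewrite lee_fin powR_ge0.
have FTC n : (\int[lebesgue_measure]_(y in `[u n, l]) (y `^ al)%:E)%E =
    ((l `^ (al + 1) / (al + 1))%:E - (u n `^ (al + 1) / (al + 1))%:E)%E.
  have dF y : 0 < y -> derivable (fun y => y `^ (al + 1) / (al + 1)) y 1.
    by move=> y0; apply: derivableM => //; apply: derivable_powR; rewrite in_itv /= y0.
  have cF y : 0 < y -> {for y, continuous (fun y => y `^ (al + 1) / (al + 1))}.
    by move=> /dF /derivable1_diffP /differentiable_continuous.
  rewrite (@continuous_FTC2 _ _ (fun y => y `^ (al + 1) / (al + 1))) //.
  - apply: derivable_within_continuous => y; rewrite in_itv /= => /andP[uy _].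
    by apply: derivable_powR; rewrite in_itv /= (lt_le_trans (u0 n)).
  - split.
    + by move=> y; rewrite in_itv /= => /andP[uy _]; apply: dF; rewrite (lt_trans (u0 n)).
    + by apply: cvg_at_right_filter; exact: cF.
    + by apply: cvg_at_left_filter; exact: cF.
  - move=> y; rewrite in_itv /= => /andP[uy _].
    have y0 : 0 < y by rewrite (lt_trans (u0 n)).
    rewrite derive1E; have D := is_derive1_powR (al + 1) y0.
    rewrite deriveM //.
    by rewrite derive_cst scaler0 add0r derive_val /= /GRing.scale /= addrK mulrA mulVf ?mul1r // gt_eqF.
under eq_fun do rewrite FTC.
move/cvg_lim => <- //; apply: cvg_lim => //.
rewrite -[X in _ --> X]sube0; under eq_fun do rewrite -EFinB.
rewrite -EFinB; apply: cvg_EFin; first by near=> n.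
apply: cvgB; first exact: cvg_cst.
rewrite -(mul0r (al + 1)^-1); apply: cvgMl.
have /cvg_at_rightP := powR_cvg0 be0; apply; split => //.
Unshelve. all: by end_near. Qed.

(** Tonelli's theorem separates the variables: the x-integral contributes |I| = l and the y-integral
    l^(al + 1) / (al + 1). *)
Lemma Vol_QI al I a b : -1 < al -> interval_ab I a b ->
  Vol al (QI I (b - a)) = ((b - a) `^ (2 + al) / (1 + al))%:E.
Proof.
move=> al1 Iab; have [ab _] := Iab; have l0 : 0 < b - a by rewrite subr_gt0.
have mI := interval_ab_measurable Iab.
set l := b - a in l0 *.
have mJ : measurable (`]0, l[%classic : set (measurableTypeR R)) by exact: measurable_itv.
pose g (y : measurableTypeR R) : \bar R := ((\1_(`]0, l[%classic) y)%:E * (y `^ al)%:E)%E.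
have g0 y : (0 <= g y)%E by rewrite /g mule_ge0 // lee_fin ?powR_ge0.
have mg : measurable_fun setT g.
  apply: emeasurable_funM; apply/measurable_EFinP.
    by apply: measurable_indic.
  exact: measurable_powR.
have intg : (\int[lebesgue_measure]_y g y)%E = (l `^ (al + 1) / (al + 1))%:E.
  rewrite -integral_powR_itvoo // [RHS]integral_mkcond.
  apply: eq_integral => y _; rewrite /g patchE indicE.
  by case: ifP => _; rewrite ?mul1e ?mul0e.
have -> : Vol al (QI I l) =
  (\int[lebesgue_measure \x lebesgue_measure]_z ((\1_I z.1)%:E * g z.2))%E.
  rewrite /Vol /intV integral_mkcond; apply: eq_integral => -[x y] _.
  rewrite patchE mul1e /g QIE in_setX /= !indicE /=.
  by case: (x \in I); case: (y \in `]0%R, l[%classic); rewrite /= ?mul1e ?mul0e.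
rewrite fubini_tonelli1 //; last 2 first.
- apply: emeasurable_funM.
    apply/measurable_EFinP.
    exact: (@measurableT_comp _ _ _ _ _ _ (\1_I : measurableTypeR R -> R) _ fst).
  exact: (@measurableT_comp _ _ _ _ _ _ g _ snd).
- by move=> z; rewrite mule_ge0 // lee_fin.
rewrite /fubini_F /=.
transitivity (\int[lebesgue_measure]_(x in setT : set (measurableTypeR R)) 
   ((l `^ (al + 1) / (al + 1))%:E * (\1_I x)%:E))%E.
  apply: eq_integral => x _.
  by rewrite ge0_integralZl // intg muleC.
rewrite ge0_integralZl //; last 2 first.
- by apply/measurable_EFinP; exact: measurable_indic.
- by rewrite lee_fin divr_ge0 ?powR_ge0 //; lra.
rewrite integral_indic // setIT.
rewrite [X in (_ * X)%E](_ : _ = l%:E); last exact: lebesgue_interval_ab.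
rewrite -EFinM; congr (_%:E).
rewrite -/l mulrAC -[in X in _ * X / _](powRr1 (ltW l0)) -powRD; last first.
  by rewrite (gt_eqF l0) implybT.
by congr (_ `^ _ / _); lra.
Qed.

End Volume.

(** * Measurability of powers *)

Section Measurability.
Context {R : realType}.
Implicit Types (D : set (plane R)) (f w : plane R -> R).

Lemma measurable_epow (r : R) :
  measurable_fun [set: R] (fun a : R => epow a%:E r).
Proof.
rewrite /epow; apply: measurable_fun_ifT.
- by apply: measurable_fun_ltr => //; exact: measurable_cst.
- by apply/measurable_EFinP; exact: measurable_powR.
- apply: measurable_fun_ifT => //.
  by apply: measurable_fun_eqr => //; exact: measurable_cst.
Qed.

Lemma measurable_fun_epow D f r : measurable_fun D f ->
  measurable_fun D (fun z => epow (f z)%:E r).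
Proof. by move=> mf; exact: (measurableT_comp (measurable_epow r)). Qed.

Lemma measurable_fun_abs_powR D f (r : R) : measurable_fun D f ->
  measurable_fun D (fun z => `|f z| `^ r).
Proof.
move=> mf; apply: (measurableT_comp (measurable_powR r)).
exact: measurableT_comp.
Qed.

Lemma measurable_fun_EFin_abs D f : measurable_fun D f ->
  measurable_fun D (fun z => `|f z|%:E).
Proof. by move=> mf; apply/measurable_EFinP; exact: measurableT_comp. Qed.

Lemma measurable_fun_powRM D f w (r : R) : measurable_fun D f -> measurable_fun D w ->
  measurable_fun D (fun z => (`|f z| `^ r * w z)%:E).
Proof.
move=> mf mw; apply/measurable_EFinP; apply: measurable_funM => //.
exact: measurable_fun_abs_powR.
Qed.

End Measurability.

(** * The dual weight *)

Section Exponents.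
Context {R : realType}.
Implicit Types (a u p : R).

Lemma conj_exponentB1 p : 1 < p -> 1 - p / (p - 1) = - (p - 1)^-1.
Proof.
move=> p1; have p0 : p - 1 != 0 by rewrite gt_eqF ?subr_gt0.
by field.
Qed.

Lemma powR_conj_inv u p : 0 < u -> 1 < p ->
  (u `^ (1 - p / (p - 1))) `^ (p - 1) = u^-1.
Proof.
move=> u0 p1; have p0 : p - 1 != 0 by rewrite gt_eqF ?subr_gt0 //.
by rewrite -powRrM conj_exponentB1 // mulNr mulVf // powR_inv1 // ltW.
Qed.

(* Pointwise substitute for Young's inequality, with constant 1 on both terms:
   one of the two summands already dominates [a]. *)
Lemma young_conj a u p : 0 <= a -> 0 < u -> 1 < p ->
  a <= u * a `^ p + u `^ (1 - p / (p - 1)).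
Proof.
move=> a0 u0 p1; have [au|ua] := leP a (u `^ (1 - p / (p - 1))).
  by rewrite (le_trans au) // lerDr mulr_ge0 ?powR_ge0 // ltW.
have a_gt0 : 0 < a by apply: le_lt_trans ua; exact: powR_ge0.
have : u^-1 <= a `^ (p - 1).
  rewrite -(powR_conj_inv u0 p1); apply: ge0_ler_powR; rewrite ?nnegrE ?powR_ge0 ?subr_ge0 ?ltW //.
move=> h; rewrite ler_wpDr ?powR_ge0 // -(mulr_powRB1 a0 (lt_trans ltr01 p1)).
by rewrite mulrCA ler_peMr // -ler_pdivrMl ?mulr1.
Qed.

(** This [s] makes the two summands equal, each being x^(1/p) y^(1/p'). Balancing them, rather than
    minimising the sum, gives the constant 2 for every p. *)
Lemma conj_powR_opt (x y p : R) : 1 < p -> 0 < x -> 0 < y ->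
  let p' := p / (p - 1) in
  let s := (y / x) `^ p'^-1 in
  s * x + s `^ (1 - p') * y = 2 * (x `^ p^-1 * y `^ p'^-1).
Proof.
move=> p1 x0 y0 p' s.
have p_neq0 : p != 0 by rewrite gt_eqF //; lra.
have p1_neq0 : p - 1 != 0 by rewrite gt_eqF ?subr_gt0.
have sE : s = y `^ p'^-1 * x `^ (- p'^-1).
  by rewrite /s powRM ?invr_ge0 ?ltW // -[x^-1]powR_inv1 ?ltW // -powRrM mulN1r.
have h1 : s * x = x `^ p^-1 * y `^ p'^-1.
  rewrite sE -mulrA -[X in _ * (_ * X)](powRr1 (ltW x0)) -powRD; last by rewrite (gt_eqF x0) implybT.
  rewrite mulrC; congr (_ `^ _ * _); rewrite /p'; field; exact/andP.
have h2 : s `^ (1 - p') * y = x `^ p^-1 * y `^ p'^-1.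
  rewrite sE powRM ?powR_ge0 // -!powRrM mulrAC -[X in _ * X * _](powRr1 (ltW y0)).
  rewrite -powRD; last by rewrite (gt_eqF y0) implybT.
  by rewrite mulrC; congr (_ `^ _ * _ `^ _); rewrite /p'; field; apply/andP.
by rewrite h1 h2 mulrDl mul1r.
Qed.

(** For x > 0 the balancing [s] applies. For x = 0 there is none, but a large [s] makes s^(1 - p') y
    as small as desired, since 1 - p' < 0. *)
Lemma le_conj_powR (A : \bar R) (x y p : R) : 1 < p -> 0 <= x -> 0 < y ->
  (forall s : R, 0 < s -> (A <= (s * x + s `^ (1 - p / (p - 1)) * y)%:E)%E) ->
  (A <= (2 * (x `^ p^-1 * y `^ (p / (p - 1))^-1))%:E)%E.
Proof.
move=> p1; rewrite le0r => /orP[/eqP ->|x0] y0 h; last first.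
  by rewrite -conj_powR_opt //; apply: h; rewrite powR_gt0 // divr_gt0.
have p_neq0 : p^-1 != 0 by rewrite invr_eq0 gt_eqF //; lra.
rewrite powR0 // mul0r mulr0; apply/lee_addgt0Pr => e e0; rewrite add0e.
(* Chosen so that s^(1 - p') y is exactly [e]. *)
have s0 : 0 < (e / y) `^ (- (p - 1)) by rewrite powR_gt0 // divr_gt0.
apply: le_trans (h _ s0) _; rewrite mulr0 add0r lee_fin -powRrM conj_exponentB1 //.
rewrite mulrNN mulfV; last by rewrite gt_eqF ?subr_gt0.
by rewrite powRr1 ?divr_ge0 ?(ltW e0) ?(ltW y0) // divfK ?lt0r_neq0.
Qed.

End Exponents.

(** * Hölder's inequality with the dual weight *)

Section Hoelder.
Context {R : realType} (al p : R).
Implicit Types (E Q : set (plane R)) (f w : plane R -> R).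

(** Hölder's inequality up to the factor 2, got by integrating [young_conj] with u = s w and then
    choosing [s]. The dual weight is integrated over the larger set [Q], because condition (b) will
    be used on a tripled box while [f] is integrated over the original one. *)
Lemma intV_hoelder E Q f w (X W : R) : 1 < p ->
  measurable E -> measurable Q -> E `<=` Q -> Q `<=` @Hplane R ->
  measurable_fun (@Hplane R) f -> measurable_fun (@Hplane R) w ->
  (forall z, Hplane z -> 0 <= w z) ->
  intV al E (fun z => (`|f z| `^ p * w z)%:E) = X%:E ->
  intV al Q (fun z => epow (w z)%:E (1 - p / (p - 1))) = W%:E -> 0 < W ->
  (intV al E (fun z => `|f z|%:E) <=
     (2 * (X `^ p^-1 * W `^ (p / (p - 1))^-1))%:E)%E.
Proof.
move=> p1 mE mQ EQ QH mf mw w0 XE WE W0.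
have EH : E `<=` @Hplane R by exact: subset_trans QH.
have mfE := measurable_funS (@measurable_Hplane R) EH mf.
have mwE := measurable_funS (@measurable_Hplane R) EH mw.
have mwQ := measurable_funS (@measurable_Hplane R) QH mw.
have mXE := measurable_fun_powRM p mfE mwE.
have mWE := measurable_fun_epow (1 - p / (p - 1)) mwE.
have mWQ := measurable_fun_epow (1 - p / (p - 1)) mwQ.
have X0 z : E z -> (0 <= (`|f z| `^ p * w z)%:E)%E.
  by move=> Ez; rewrite lee_fin mulr_ge0 ?powR_ge0 ?w0 //; exact: EH.
have r_lt0 : 1 - p / (p - 1) < 0 by rewrite conj_exponentB1 // oppr_lt0 invr_gt0 subr_gt0.
apply: le_conj_powR => //; first by rewrite -lee_fin -XE intV_ge0.
move=> s s0; set t := s `^ _.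
have t0 : 0 < t by rewrite powR_gt0.
apply: (@le_trans _ _ (intV al E (fun z => s%:E * (`|f z| `^ p * w z)%:E +
    t%:E * epow (w z)%:E (1 - p / (p - 1)))%E)).
  apply: le_intV => //.
  - exact: measurable_fun_EFin_abs.
  - by apply: emeasurable_funD; apply: emeasurable_funM.
  (* Where [w] vanishes the dual weight is infinite and the bound trivial. Elsewhere s^(1 - p') w^(1
     - p') = (s w)^(1 - p'). *)
  move=> z Ez; have := w0 z (EH z Ez); rewrite le0r => /orP[/eqP ->|wz].
    by rewrite epow0_neg // gt0_muley ?lte_fin // mulr0 mule0 add0e leey.
  rewrite epow_pos // -!EFinM -EFinD lee_fin /t -powRM ?(ltW s0) ?(ltW wz) //.
  rewrite (_ : s * (_ * w z) = (s * w z) * `|f z| `^ p); last by ring.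
  by apply: young_conj => //; exact: mulr_gt0.
rewrite intVD //; first last.
- by move=> z Ez; rewrite mule_ge0 ?epow_ge0 // lee_fin ltW.
- by move=> z Ez; rewrite mule_ge0 ?X0 // lee_fin ltW.
- exact: emeasurable_funM.
- exact: emeasurable_funM.
rewrite !intVZ ?(ltW s0) ?(ltW t0) //; last by move=> z _; exact: epow_ge0.
rewrite XE EFinD EFinM leeD2l // EFinM lee_wpmul2l ?lee_fin ?(ltW t0) // -WE.
by apply: subset_intV => // z _; exact: epow_ge0.
Qed.

End Hoelder.

(** * The essential infimum, for p = 1 *)

Section EssInf.
Context {R : realType} (al : R).
Implicit Types (E Q : set (plane R)) (f w : plane R -> R).

Lemma measurable_sublevel Q w (c : R) : measurable Q -> measurable_fun Q w ->
  measurable (Q `&` [set z | ((w z)%:E < c%:E)%E]).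
Proof.
move=> mQ mw; have -> : [set z | ((w z)%:E < c%:E)%E] = w @^-1` `]-oo, c[%classic.
  by apply/seteqP; split => z; rewrite /= lte_fin in_itv.
by apply: mw => //; exact: measurable_itv.
Qed.

(** Some admissible level [d] exceeds [c], and the sublevel set of [c] lies in the null sublevel set
    of [d]. *)
Lemma leb2_sublevel_eq0 Q w (c : R) : measurable Q -> measurable_fun Q w ->
  (c%:E < essinf_on Q w)%E -> leb2 (Q `&` [set z | ((w z)%:E < c%:E)%E]) = 0%E.
Proof.
move=> mQ mw /ereal_sup_gt[d /= Qd cd]; apply/eqP; rewrite eq_le measure_ge0 andbT.
case: d Qd cd => [d| |] // Qd cd; last first.
  rewrite -[X in (_ <= X)%E]Qd; apply: le_measure; rewrite ?inE.
  - exact: measurable_sublevel.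
  - rewrite (_ : [set z | _] = setT) ?setIT //.
    by apply/seteqP; split => // z _; rewrite /= ltry.
  - by move=> z [Qz zc]; split => //=; exact: ltry.
rewrite -[X in (_ <= X)%E]Qd; apply: le_measure; rewrite ?inE.
- exact: measurable_sublevel.
- exact: measurable_sublevel.
- by move=> z [Qz zc]; split => //=; exact: lt_trans cd.
Qed.

Lemma essinf_on_ge0 Q w : (forall z, Q z -> 0 <= w z) -> (0 <= essinf_on Q w)%E.
Proof.
move=> w0; apply: ereal_sup_ubound => /=.
rewrite (_ : _ `&` _ = set0) ?measure0 //.
by apply/seteqP; split => // z [/w0 wz /=]; rewrite lte_fin ltNge wz.
Qed.

(** [Q] is the union of the sets {w < n}. An infinite essential infimum would make all of them null,
    hence also [Q]. *)
Lemma essinf_on_lty Q w : measurable Q -> measurable_fun Q w ->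
  (0 < leb2 Q)%E -> (essinf_on Q w < +oo)%E.
Proof.
move=> mQ mw Q0; rewrite ltey; apply/eqP => wy.
suff Q00 : leb2 Q = 0%E by rewrite Q00 ltxx in Q0.
have : (@leb2 R).-negligible (\bigcup_n (Q `&` [set z | ((w z)%:E < n%:R%:E)%E])).
  apply: negligible_bigcup => n; apply/negligibleP; first exact: measurable_sublevel.
  by apply: leb2_sublevel_eq0 => //; rewrite wy ltry.
rewrite (_ : \bigcup_n _ = Q) => [/negligibleP ->//|].
apply/seteqP; split => [z [n _ []]//|z Qz].
exists (Num.bound `|w z|) => //; split => //=.
by rewrite lte_fin; exact: le_lt_trans (ler_norm _) (archi_boundP (normr_ge0 _)).
Qed.

(** The integrands compare off the set {w < c}, which is null in [Q] because [c] lies strictly below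
    the essential infimum. *)
Lemma intV_essinf E Q f w (c : R) : measurable E -> measurable Q -> E `<=` Q ->
  Q `<=` @Hplane R -> measurable_fun (@Hplane R) f -> measurable_fun (@Hplane R) w ->
  (forall z, Hplane z -> 0 <= w z) -> 0 <= c -> (c%:E < essinf_on Q w)%E ->
  (c%:E * intV al E (fun z => `|f z|%:E) <= intV al E (fun z => (`|f z| * w z)%:E))%E.
Proof.
move=> mE mQ EQ QH mf mw w0 c0 cw.
have EH : E `<=` @Hplane R by exact: subset_trans QH.
have mfE := measurable_funS (@measurable_Hplane R) EH mf.
have mwE := measurable_funS (@measurable_Hplane R) EH mw.
have mwQ := measurable_funS (@measurable_Hplane R) QH mw.
have Q0 := leb2_sublevel_eq0 mQ mwQ cw.
rewrite -intVZ //; last exact: measurable_fun_EFin_abs.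
apply: ae_ge0_le_integral => //.
- by move=> z Ez; rewrite !mule_ge0 // lee_fin ?powR_ge0.
- by apply: measurable_yweight; apply: emeasurable_funM => //; exact: measurable_fun_EFin_abs.
- by move=> z Ez; rewrite mule_ge0 // lee_fin ?powR_ge0 // mulr_ge0 // w0 //; exact: EH.
- apply: measurable_yweight; apply/measurable_EFinP; apply: measurable_funM => //.
  exact: measurableT_comp.
exists (Q `&` [set z | ((w z)%:E < c%:E)%E]); split => //.
  exact: measurable_sublevel.
move=> z /= /not_implyP[Ez /negP]; rewrite -ltNge => h; split; first exact: EQ.
rewrite ltNge; apply/negP => cw'; move: h; rewrite ltNge => /negP; apply.
rewrite lee_wpmul2r ?lee_fin ?powR_ge0 // mulrC ler_wpM2l //.
Qed.

End EssInf.

(** * From condition (b) to the box inequality *)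

Section BoxBound.
Context {R : realType}.
Implicit Types (al ga l p q : R) (E Q : set (plane R)) (f w : plane R -> R).

(** Here (2 + al) d = 2 + al - ga, and l^(2 + al) is 1 + al times the volume of the box. This
    converts the normalisation of the maximal function into that of (b) and (c). *)
Lemma powR_side_Vol al ga l : -1 < al -> 0 < l ->
  let d := 1 - ga / (2 + al) in
  l `^ (- (2 + al - ga)) =
    (1 + al) `^ (- d) * (l `^ (2 + al) / (1 + al)) `^ (- d).
Proof.
move=> al1 l0 d; have al0 : 0 < 1 + al by lra.
rewrite -powRM ?(ltW al0) ?divr_ge0 ?powR_ge0 ?(ltW al0) //.
rewrite mulrC divfK ?lt0r_neq0 // -powRrM; congr (_ `^ _).
by rewrite /d; field; rewrite lt0r_neq0 //; lra.
Qed.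

(** Puts the cases p = 1 and p > 1 into one form: [G] is the dual norm, 1 / essinf w or W^(1/p'),
    with which (b) becomes an inequality between reals and comes with a Hölder bound. Once [m] is
    nonzero, the bound by [C2] forces [m] and the dual norm to be finite. *)
Lemma condB_dual al ga p q w (I : set R) (a b C2 : R) (m : \bar R) :
  1 <= p -> p <= q -> -1 < al ->
  measurable_fun (@Hplane R) w -> (forall z, Hplane z -> 0 <= w z) ->
  interval_ab I a b -> (0 <= m)%E ->
  let Q := QI I (b - a) in
  let p' := p / (p - 1) in
  (epow (Vol al Q) (q * (ga / (2 + al) - p^-1))%R *
    (if (1 < p)%R then
       epow (((fine (Vol al Q))^-1)%R%:E *
             intV al Q (fun z => epow (w z)%:E (1 - p')%R)) (q / p')%R
     else epow (essinf_on Q w) (- q)%R) * m <= C2%:E)%E ->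
  m = 0%E \/ exists m' G : R, [/\ m = m'%:E, 0 < G,
    fine (Vol al Q) `^ (- ((1 - ga / (2 + al)) * q)) * G `^ q * m' <= C2 &
    forall E f X, measurable E -> E `<=` Q -> measurable_fun (@Hplane R) f ->
      intV al E (fun z => (`|f z| `^ p * w z)%:E) = X%:E ->
      (intV al E (fun z => `|f z|%:E) <= (2 * (X `^ p^-1 * G))%:E)%E].
Proof.
move=> p1 pq al1 mw w0 Iab m0 Q p'.
have [ab _] := Iab; have l0 : 0 < b - a by rewrite subr_gt0.
have al0 : 0 < 1 + al by lra.
have p_gt0 : 0 < p by lra.
have q_gt0 : 0 < q by lra.
have mQ : measurable (Q : set (plane R)) by exact: measurable_QI Iab.
have QH : Q `<=` @Hplane R by exact: QI_Hplane.
have mwQ := measurable_funS (@measurable_Hplane R) QH mw.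
have Q0 : (0 < @leb2 R Q)%E by rewrite leb2_QI // lte_fin exprn_gt0.
rewrite (Vol_QI al1 Iab); set V := (_ / _)%R; rewrite [fine _]/=.
have V0 : 0 < V by rewrite divr_gt0 ?powR_gt0.
clearbody V; rewrite epow_pos // => Bm; have [->|mn0] := eqVneq m 0%E; [by left|right].
have m_gt0 : (0 < m)%E by rewrite lt0e mn0.
have Ve0 r : 0 < V `^ r by rewrite powR_gt0.
move: Bm; case: ifPn => [p_gt1|]; last first.
  rewrite -leNgt => p_le1; have {p_le1} {}p1 : p = 1 by apply/eqP; rewrite eq_le p1 p_le1.
  have := essinf_on_lty mQ mwQ Q0; have : (0 <= essinf_on Q w)%E by apply: essinf_on_ge0 => z /QH/w0.
  case Ee : (essinf_on Q w) => [e| |] // + _; rewrite lee_fin le0r => /orP[/eqP e0|e0].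
    by rewrite e0 epow0_neg ?oppr_lt0 // gt0_muley ?lte_fin // gt0_mulye.
  rewrite epow_pos // -EFinM.
  have k0 : 0 < V `^ (q * (ga / (2 + al) - p^-1)) * e `^ (- q) by rewrite mulr_gt0 ?powR_gt0.
  case: m m0 mn0 m_gt0 => [m| |] // m0 mn0 m_gt0; last by rewrite gt0_muley ?lte_fin.
  rewrite -EFinM lee_fin => le2; exists m, e^-1; split => //.
  - by rewrite invr_gt0.
  - apply: le_trans le2; rewrite ler_wpM2r // -[e^-1]powR_inv1 ?(ltW e0) // -powRrM mulN1r.
    rewrite le_eqVlt; apply/orP; left; apply/eqP; congr (_ `^ _ * _).
    by rewrite p1; field; rewrite lt0r_neq0 //; lra.
  - move=> E f X mE EQ mf; rewrite p1 => XE.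
    (* Half of the essential infimum lies strictly below it; this accounts for the factor 2 when p =
       1. *)
    have e2 : 0 < e / 2 by rewrite divr_gt0.
    have e2e : ((e / 2)%:E < essinf_on Q w)%E by rewrite Ee lte_fin gtr_pMr // invf_lt1 ?ltr1n.
    have := intV_essinf al mE mQ EQ QH mf mw w0 (ltW e2) e2e.
    have -> : intV al E (fun z => (`|f z| * w z)%:E) = X%:E.
      by rewrite -XE; apply: eq_intV => z _; rewrite powRr1.
    have X0 : 0 <= X.
      rewrite -lee_fin -XE; apply: intV_ge0 => z Ez.
      by rewrite lee_fin mulr_ge0 ?powR_ge0 // w0 //; apply: QH; exact: EQ.
    have : (0 <= intV al E (fun z => `|f z|%:E))%E by apply: intV_ge0 => z _; rewrite lee_fin.
    case: (intV al E (fun z => `|f z|%:E)) => [A| |] // A0; last by rewrite gt0_muley ?lte_fin.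
    rewrite -EFinM !lee_fin invr1 powRr1 // => h.
    by rewrite mulrA ler_pdivlMr // -(ler_pM2l (_ : 0 < 2^-1)) ?invr_gt0 //; lra.
have p'_gt0 : 0 < p' by rewrite divr_gt0 // subr_gt0.
have qp'_gt0 : 0 < q / p' by exact: divr_gt0.
have mW := measurable_fun_epow (1 - p') mwQ.
have : (0 < intV al Q (fun z => epow (w z)%:E (1 - p')))%E.
  apply: intV_gt0 => // z Qz; have := w0 z (QH z Qz).
  rewrite le0r => /orP[/eqP ->|wz]; last by rewrite epow_gt0 ?lte_fin ?ltry.
  by rewrite epow0_neg ?ltry // /p' conj_exponentB1 // oppr_lt0 invr_gt0 subr_gt0.
case WE : (intV _ _ _) => [W| |] // W0; last first.
  rewrite gt0_muley ?lte_fin ?invr_gt0 // epow_pinfty //.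
  by rewrite gt0_muley ?lte_fin // gt0_mulye.
have W_gt0 : 0 < W by [].
rewrite -EFinM epow_pos; last by rewrite mulr_gt0 ?invr_gt0.
rewrite -EFinM.
have k0 : 0 < V `^ (q * (ga / (2 + al) - p^-1)) * (V^-1 * W) `^ (q / p').
  by rewrite mulr_gt0 // powR_gt0 // mulr_gt0 ?invr_gt0.
case: m m0 mn0 m_gt0 => [m| |] // m0 mn0 m_gt0; last by rewrite gt0_muley ?lte_fin.
rewrite -EFinM lee_fin => le2; exists m, (W `^ p'^-1); split => //.
- by rewrite powR_gt0.
- apply: le_trans le2; rewrite ler_wpM2r // powRM ?invr_ge0 ?(ltW V0) ?(ltW W_gt0) //.
  rewrite -[V^-1]powR_inv1 ?(ltW V0) // -!powRrM mulN1r mulrA -powRD; last by rewrite (gt_eqF V0) implybT.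
  rewrite le_eqVlt; apply/orP; left; apply/eqP; congr (_ `^ _ * _ `^ _).
  + rewrite /p'; field; rewrite !lt0r_neq0 ?subr_gt0 //; lra.
  + by rewrite mulrC.
- by move=> E f X mE EQ mf XE; exact: (@intV_hoelder _ al p E Q f w X W).
Qed.

(** The normalising power and [mu] see the whole box, the integrals only the subset [E]: this gap
    lets integrals over the box of J control the measure of the box of 3J. *)
Definition box_bound al ga p q w (mu : set (R * R) -> \bar R) (K : R) :=
  forall (I : set R) (a b : R) E f, interval_ab I a b -> measurable E ->
    E `<=` QI I (b - a) -> measurable_fun (@Hplane R) f ->
    (epow (((b - a) `^ (- (2 + al - ga)))%:E * intV al E (fun z => `|f z|%:E)) q *
       mu (QI I (b - a))
     <= K%:E * epow (intV al E (fun z => (`|f z| `^ p * w z)%:E)) (q / p))%E.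

Lemma condB_box al ga p q w (mu : {measure set (R * R) -> \bar R}) (C2 : R) :
  1 <= p -> p <= q -> -1 < al -> 0 < C2 ->
  measurable_fun (@Hplane R) w -> (forall z, Hplane z -> 0 <= w z) ->
  let p' := p / (p - 1) in
  (forall (I : set R) (a b : R), interval_ab I a b ->
    let Q := QI I (b - a) in
    (epow (Vol al Q) (q * (ga / (2 + al) - p^-1))%R *
     (if (1 < p)%R then
        epow (((fine (Vol al Q))^-1)%R%:E *
              intV al Q (fun z => epow (w z)%:E (1 - p')%R)) (q / p')%R
      else epow (essinf_on Q w) (- q)%R) * mu Q <= C2%:E)%E) ->
  exists K, 0 < K /\ box_bound al ga p q w mu K.
Proof.
move=> p1 pq al1 C20 mw w0 p' B.
have al0 : 0 < 1 + al by lra.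
have p_gt0 : 0 < p by lra.
have q_gt0 : 0 < q by lra.
have qp_gt0 : 0 < q / p by rewrite divr_gt0.
set d := 1 - ga / (2 + al); set c := (1 + al) `^ (- d).
have c0 : 0 < c by rewrite powR_gt0.
(* The 2 is the constant of [condB_dual], and [c] comes from converting side length to volume. *)
have K0 : 0 < (c * 2) `^ q * C2.
  by rewrite mulr_gt0 ?powR_gt0 ?mulr_gt0.
exists ((c * 2) `^ q * C2); split=> // I a b E f Iab mE EQ mf.
have [ab _] := Iab; have l0 : 0 < b - a by rewrite subr_gt0.
have EH : E `<=` @Hplane R by apply: subset_trans EQ _; exact: QI_Hplane.
have X0 : (0 <= intV al E (fun z => (`|f z| `^ p * w z)%:E))%E.
  by apply: intV_ge0 => z Ez; rewrite lee_fin mulr_ge0 ?powR_ge0 // w0 //; exact: EH.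
have A0 : (0 <= intV al E (fun z => `|f z|%:E))%E by apply: intV_ge0 => z _; rewrite lee_fin.
have [->|[m [G [mE' G0 le2 H]]]] :=
    condB_dual p1 pq al1 mw w0 Iab (measure_ge0 mu _) (B I a b Iab).
  by rewrite mule0 mule_ge0 ?epow_ge0 // lee_fin ltW.
have m0 : 0 <= m by rewrite -lee_fin -mE' measure_ge0.
rewrite mE' powR_side_Vol // -/d -/c.
rewrite (Vol_QI al1 Iab) [fine _]/= -/d in le2.
set V := _ / (1 + al) in le2 *.
have V0 : 0 < V by rewrite divr_gt0 ?powR_gt0.
clearbody V.
case XE : (intV al E (fun z => (`|f z| `^ p * w z)%:E)) X0 => [X| |] // X0; last first.
  by rewrite epow_pinfty // gt0_muley ?lte_fin // leey.
have := H E f X mE EQ mf XE.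
case: (intV al E (fun z => `|f z|%:E)) A0 => [A| |] // A0.
rewrite lee_fin => AX; rewrite !lee_fin in A0 X0.
have lA : 0 <= c * V `^ (- d) * A by rewrite !mulr_ge0 ?powR_ge0.
rewrite -EFinM !epow_fin // -!EFinM lee_fin.
have h1 : (c * V `^ (- d) * A) `^ q <= (c * 2) `^ q * X `^ (q / p) * (V `^ (- (d * q)) * G `^ q).
  apply: (@le_trans _ _ ((c * V `^ (- d) * (2 * (X `^ p^-1 * G))) `^ q)).
    apply: (ge0_ler_powR (ltW q_gt0)); rewrite ?nnegrE //.
      by rewrite !mulr_ge0 ?powR_ge0 ?(ltW G0).
    by rewrite ler_wpM2l // mulr_ge0 ?powR_ge0.
  rewrite (_ : c * _ * _ = (c * 2) * (X `^ p^-1) * (V `^ (- d) * G)); last by ring.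
  rewrite !powRM ?mulr_ge0 ?powR_ge0 ?(ltW G0) ?(ltW c0) //.
  by rewrite -!powRrM mulNr [p^-1 * q]mulrC.
apply: le_trans (ler_wpM2r m0 h1) _.
rewrite [leRHS]mulrAC -[leLHS]mulrA; apply: ler_wpM2l => //.
by rewrite mulr_ge0 ?powR_ge0.
Qed.

End BoxBound.

(** * Superadditivity of powers *)

Section Superadditivity.
Context {R : realType}.

(** Write x^r = x x^(r - 1), enlarge the second factor to (x + y)^(r - 1), do the same for y, and
    add. *)
Lemma powR_superadditive (x y r : R) : 0 <= x -> 0 <= y -> 1 <= r ->
  x `^ r + y `^ r <= (x + y) `^ r.
Proof.
move=> x0 y0 r1; have r0 : 0 < r by lra.
rewrite -!(mulr_powRB1 _ r0) ?addr_ge0 // mulrDl.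
by apply: lerD; apply: ler_wpM2l => //; apply: ge0_ler_powR;
  rewrite ?nnegrE ?subr_ge0 ?addr_ge0 ?lerDl ?lerDr.
Qed.

Lemma epow_superadditive (x y : \bar R) (r : R) : (0 <= x)%E -> (0 <= y)%E -> 1 <= r ->
  (epow x r + epow y r <= epow (x + y) r)%E.
Proof.
move=> x0 y0 r1; have r0 : 0 < r by lra.
case: x x0 => [x| |] // x0; last by rewrite addye ?epow_pinfty ?leey // -ltNye (lt_le_trans _ y0).
case: y y0 => [y| |] // y0; last by rewrite addey ?epow_pinfty ?leey.
rewrite !lee_fin in x0 y0.
by rewrite -EFinD !epow_fin ?addr_ge0 // -EFinD lee_fin powR_superadditive.
Qed.

End Superadditivity.

(** * Covering by disjoint intervals *)

Section Covering.
Context {R : realType}.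
Implicit Types (J : R * R) (s t : seq (R * R)).

Definition open_box J : set (plane R) := QI `]J.1, J.2[%classic (J.2 - J.1).
(** The concentric interval of three times the length. *)
Definition triple J : R * R := (2 * J.1 - J.2, 2 * J.2 - J.1).
(** A decidable form of disjointness for nonempty open intervals. *)
Definition separated J J' := (J.2 <= J'.1) || (J'.2 <= J.1).

Lemma interval_ab_oo (a b : R) : a < b -> interval_ab `]a, b[%classic a b.
Proof. by move=> ab; split=> //; split=> //; exact: subset_itv_oo_cc. Qed.

Lemma triple_lt J : J.1 < J.2 -> (triple J).1 < (triple J).2.
Proof. by move=> h; rewrite /triple /=; lra. Qed.

Lemma measurable_open_box J : J.1 < J.2 -> measurable (open_box J).
Proof. by move=> h; apply: measurable_QI; exact: interval_ab_oo. Qed.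

Lemma open_box_separated J J' : separated J J' -> open_box J `&` open_box J' = set0.
Proof.
move=> sJ; apply/seteqP; split => // -[x y]; rewrite /open_box /QI /=.
rewrite !in_itv /= => -[[/andP[h1 h2] _] [/andP[h3 h4] _]].
by case/orP: sJ => ?; lra.
Qed.

(** An interval that meets J' and is no longer sticks out of it by less than the length of J'; its
    box is also no taller than the tripled one. *)
Lemma open_box_triple J J' : J.1 < J.2 -> J'.1 < J'.2 -> J.2 - J.1 <= J'.2 - J'.1 ->
  ~~ separated J J' ->
  open_box J `<=` open_box (triple J').
Proof.
move=> h h' le; rewrite negb_or -!ltNge => /andP[h1 h2] [x y].
rewrite /open_box /QI /triple /= !in_itv /= => -[/andP[h3 h4] [h5 h6]].
by split; [apply/andP; split; lra|split=> //; lra].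
Qed.

(* [s] lists the intervals by increasing length, so an interval that meets an
   already selected one is no longer than it. *)
Lemma vitali_finite s : sorted (fun J J' => J.2 - J.1 <= J'.2 - J'.1) s ->
  (forall J, J \in s -> J.1 < J.2) ->
  exists t, [/\ pairwise separated t, {subset t <= s} &
    \big[setU/set0]_(J <- s) open_box J `<=`
      \big[setU/set0]_(J <- t) open_box (triple J)].
Proof.
elim: s => [_ _|J s IH]; first by exists [::]; split => //; rewrite !big_nil.
move=> /= ps lts.
have tr : transitive (fun J J' : R * R => J.2 - J.1 <= J'.2 - J'.1).
  by move=> ? ? ?; exact: le_trans.
have [t [pt ts sub]] := IH (path_sorted ps) (fun J' h => lts J' (mem_behead (s := J :: s) h)).
have minJ J' : J' \in s -> J.2 - J.1 <= J'.2 - J'.1.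
  by move=> J's; have /allP := order_path_min tr ps; exact.
have [sepJ|] := boolP (all (separated J) t).
  exists (J :: t); split.
  - by rewrite /= sepJ pt.
  - move=> J'; rewrite !inE => /orP[->//|/ts ->]; exact: orbT.
  - rewrite !big_cons; apply: setUSS => //.
    have ltJ := lts J (mem_head _ _).
    by apply: open_box_triple; rewrite ?lexx // /separated orbb -ltNge.
rewrite -has_predC => /hasP[J' J't /= nsep].
exists t; split => //.
  by move=> J'' /ts J''s; rewrite inE J''s orbT.
rewrite big_cons => z [zJ|]; last exact: sub.
rewrite -bigcup_seq; exists J' => //.
by apply: open_box_triple zJ => //; [exact: lts (mem_head _ _)|apply: lts; rewrite inE ts ?orbT|exact/minJ/ts].
Qed.

End Covering.

(** * Weak-type bound from the box inequality *)

Section WeakType.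
Context {R : realType} (al ga p q : R) (w : plane R -> R).
Variables (mu : {measure set (R * R) -> \bar R}) (K : R).
Hypotheses (p1 : 1 <= p) (pq : p <= q) (s_gt0 : 0 < 2 + al - ga) (K0 : 0 < K).
Hypotheses (mw : measurable_fun (@Hplane R) w) (w0 : forall z, Hplane z -> 0 <= w z).
Hypothesis box : box_bound al ga p q w mu K.
Variables (f : plane R -> R) (lambda : R).
Hypotheses (mf : measurable_fun (@Hplane R) f) (lambda0 : 0 < lambda).
Implicit Types (J : R * R) (s t : seq (R * R)).

Let g z := (`|f z| `^ p * w z)%:E.
(** [K] is the constant of the box inequality, the power of 3 pays for tripling intervals, and
    lambda^q is the one in (a). *)
Let C := K * (3 `^ (2 + al - ga)) `^ q / lambda `^ q.

Definition good_interval J := J.1 < J.2 /\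
  (lambda%:E < ((J.2 - J.1) `^ (- (2 + al - ga)))%:E *
     intV al (open_box J) (fun z => `|f z|%:E))%E.

Let p_gt0 : 0 < p. Proof. exact: lt_le_trans ltr01 p1. Qed.
Let q_gt0 : 0 < q. Proof. exact: lt_le_trans p_gt0 pq. Qed.
Let qp_ge1 : 1 <= q / p. Proof. by rewrite ler_pdivlMr // mul1r. Qed.
Let C0 : 0 < C. Proof. by rewrite /C divr_gt0 ?mulr_gt0 ?powR_gt0. Qed.

Let mg : measurable_fun (@Hplane R : set (plane R)) g.
Proof. exact: measurable_fun_powRM. Qed.

Let g0 z : Hplane z -> (0 <= g z)%E.
Proof. by move=> Hz; rewrite lee_fin mulr_ge0 ?powR_ge0 ?w0. Qed.

(** The box inequality over 3J is used with [E] the box over J. Normalising by the length of 3J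
    costs the factor 3^(-(2 + al - ga)), so the average still exceeds that multiple of [lambda]. *)
Lemma mu_triple_le J : good_interval J ->
  (mu (open_box (triple J)) <= C%:E * epow (intV al (open_box J) g) (q / p))%E.
Proof.
move=> [ltJ avg].
have ltJ3 := triple_lt ltJ.
have sub : open_box J `<=` open_box (triple J).
  by apply: open_box_triple; rewrite ?lexx // /separated orbb -ltNge.
have := box (interval_ab_oo ltJ3) (measurable_open_box ltJ) sub mf.
have l3 : (triple J).2 - (triple J).1 = 3 * (J.2 - J.1) by rewrite /triple /=; ring.
have l0 : 0 < J.2 - J.1 by rewrite subr_gt0.
rewrite l3 -/(open_box (triple J)).
have -> : QI `](triple J).1, (triple J).2[%classic (3 * (J.2 - J.1)) = open_box (triple J).
  by rewrite /open_box l3.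
rewrite powRM ?(ltW l0) // EFinM -muleA => bnd.
set c := 3 `^ (- (2 + al - ga)) in bnd.
have c0 : 0 < c by rewrite powR_gt0.
have : (((c * lambda) `^ q)%:E * mu (open_box (triple J)) <=
    K%:E * epow (intV al (open_box J) g) (q / p))%E.
  apply: le_trans bnd; rewrite lee_wpmul2r ?measure_ge0 //.
  rewrite -epow_pos ?mulr_gt0 //; apply: le_epow => //.
    by rewrite lee_fin mulr_ge0 // ltW.
  by rewrite EFinM lee_wpmul2l ?lee_fin ?(ltW c0) // ltW.
have cl : 0 < (c * lambda) `^ q by rewrite powR_gt0 // mulr_gt0.
rewrite -lee_pdivlMl // => /le_trans; apply.
rewrite muleA -EFinM lee_wpmul2r ?epow_ge0 // lee_fin /C.
rewrite powRM ?(ltW c0) ?(ltW lambda0) // invfM mulrC mulrA.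
have -> // : (c `^ q)^-1 = (3 `^ (2 + al - ga)) `^ q.
by rewrite /c -powRN -!powRrM mulrN mulNr opprK.
Qed.

(** By induction on [t]: [mu] is subadditive over the tripled boxes, the integral of [g] is additive
    over the separated ones, and q / p >= 1 makes its power superadditive. *)
Lemma mu_triples_le t : pairwise separated t -> (forall J, J \in t -> good_interval J) ->
  [/\ measurable (\big[setU/set0]_(J <- t) open_box J),
      measurable (\big[setU/set0]_(J <- t) open_box (triple J)) &
  (mu (\big[setU/set0]_(J <- t) open_box (triple J)) <=
    C%:E * epow (intV al (\big[setU/set0]_(J <- t) open_box J) g) (q / p))%E].
Proof.
elim: t => [_ _|J t IH].
  rewrite !big_nil; split => //.
  by rewrite measure0 mule_ge0 ?epow_ge0 // lee_fin ltW.
rewrite pairwise_cons => /andP[/allP sepJ pt] goodt.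
have goodJ := goodt J (mem_head _ _).
have [|mD mT le2] := IH pt.
  by move=> J' J't; apply: goodt; rewrite inE J't orbT.
have mJ := measurable_open_box goodJ.1.
have mJ3 := measurable_open_box (triple_lt goodJ.1).
rewrite !big_cons; split; [exact: measurableU|exact: measurableU|].
have subadd (A B : set (R * R)) : measurable A -> measurable B ->
    (mu (A `|` B) <= mu A + mu B)%E by move=> mA mB; exact: measureU2.
apply: le_trans (subadd _ _ mJ3 mT) _.
have DH : open_box J `|` \big[setU/set0]_(J <- t) open_box J `<=` @Hplane R.
  rewrite -bigcup_seq => z [|[J' _]]; exact: QI_Hplane.
have intU : intV al (open_box J `|` \big[setU/set0]_(J <- t) open_box J) g =
    (intV al (open_box J) g + intV al (\big[setU/set0]_(J <- t) open_box J) g)%E.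
  apply: intV_setU => //.
  - exact: measurable_funS (@measurable_Hplane R) DH mg.
  - by move=> z /DH/g0.
  - rewrite -bigcup_seq setI_bigcupr; apply: bigcup0 => J' J't.
    by apply: open_box_separated; exact: sepJ.
apply: le_trans (leeD (mu_triple_le goodJ) le2) _.
rewrite -muleDr ?ge0_adde_def ?inE ?epow_ge0 // lee_wpmul2l ?lee_fin ?(ltW C0) // intU.
by apply: epow_superadditive => //; apply: intV_ge0 => z Dz; apply: g0; apply: DH; [left|right].
Qed.

(** Sorting by length prepares the Vitali selection. The bound is independent of [s], which permits
    the passage to countably many boxes. *)
Lemma mu_boxes_le s : (forall J, J \in s -> good_interval J) ->
  (mu (\big[setU/set0]_(J <- s) open_box J) <=
    C%:E * epow (intV al (@Hplane R) g) (q / p))%E.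
Proof.
move=> goods.
pose le_len (J J' : R * R) := J.2 - J.1 <= J'.2 - J'.1.
have tot : total le_len by move=> J J'; exact: le_total.
rewrite -(perm_big _ (permEl (perm_sort le_len s))) /=.
have goods' J : J \in sort le_len s -> good_interval J by rewrite mem_sort; exact: goods.
have [t [pt ts sub]] := vitali_finite (sort_sorted tot s) (fun J Js => (goods' J Js).1).
have [mD mT le2] := mu_triples_le pt (fun J Jt => goods' J (ts J Jt)).
have mS : measurable (\big[setU/set0]_(J <- sort le_len s) open_box J).
  by rewrite big_seq; apply: bigsetU_measurable => J /goods'[? _]; exact: measurable_open_box.
apply: (@le_trans _ _ (mu (\big[setU/set0]_(J <- t) open_box (triple J)))).
  by apply: le_measure; rewrite ?inE.
apply: le_trans le2 _; rewrite lee_wpmul2l ?lee_fin ?(ltW C0) //.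
have DH : \big[setU/set0]_(J <- t) open_box J `<=` @Hplane R.
  by rewrite -bigcup_seq => z [J' _]; exact: QI_Hplane.
apply: le_epow; first exact: lt_le_trans ltr01 qp_ge1.
  by apply: intV_ge0 => z /DH/g0.
by apply: subset_intV => //; exact: measurable_Hplane.
Qed.

Definition rat_interval (r : rat * rat) : R * R := (ratr r.1, ratr r.2).

(* Enlarging an interval only increases its integral, and the power of its
   length is continuous, so the endpoints can be moved outwards to rationals. *)
Lemma Mfrac_superlevelE :
  [set z | Hplane z /\ (lambda%:E < Mfrac al ga f z)%E] =
  \bigcup_(r in [set r | good_interval (rat_interval r)]) open_box (rat_interval r).
Proof.
apply/seteqP; split => [z [Hz]|z [r [lt_r avg] zr]]; last first.
  split; first exact: QI_Hplane zr.
  apply: lt_le_trans avg _; apply: ereal_sup_ubound => /=.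
  exists `]ratr r.1, ratr r.2[%classic, (ratr r.1), (ratr r.2).
  by split; [exact: interval_ab_oo|split].
move=> /ereal_sup_gt[_ [I [a [b [Iab [zQ ->]]]]]].
have [ab [_ Isub]] := Iab; have l0 : 0 < b - a by rewrite subr_gt0.
have := s_gt0; set s := 2 + al - ga => s0.
have A0 : (0 <= intV al (QI I (b - a)) (fun z => `|f z|%:E))%E.
  by apply: intV_ge0 => ? _; rewrite lee_fin.
move=> avg.
have [t0 [lt0 ht]] : exists t0 : R, b - a < t0 /\ forall t : R, b - a < t -> t < t0 ->
    (lambda%:E < (t `^ (- s))%:E * intV al (QI I (b - a)) (fun z => `|f z|%:E))%E.
  move: avg A0; case: (intV _ _ _) => [A| |] // avg A0; last first.
    exists (b - a + 1); split; first by rewrite ltrDl.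
    by move=> t tl _; rewrite gt0_muley ?ltry // lte_fin powR_gt0 // (lt_trans l0).
  move: avg; rewrite -EFinM lte_fin powRN mulrC ltr_pdivlMr ?powR_gt0 // => avg.
  have lA : (b - a) `^ s < A / lambda by rewrite ltr_pdivlMr // mulrC.
  have Al0 : 0 <= A / lambda by rewrite ltW // (le_lt_trans _ lA) ?powR_ge0.
  have root x : 0 <= x -> (x `^ s) `^ s^-1 = x.
    by move=> x0; rewrite -powRrM mulfV ?lt0r_neq0 // powRr1.
  (* At this length t^(-s) A equals [lambda]; every shorter one keeps the average above [lambda]. *)
  exists ((A / lambda) `^ s^-1); split.
    rewrite -[ltLHS]root ?(ltW l0) //.
    by apply: gt0_ltr_powR; rewrite ?nnegrE ?invr_gt0 ?powR_ge0.
  move=> t tl tu; have t_gt0 := lt_trans l0 tl.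
  rewrite -EFinM lte_fin powRN mulrC ltr_pdivlMr ?powR_gt0 // mulrC -ltr_pdivlMr //.
  rewrite [ltRHS](_ : _ = ((A / lambda) `^ s^-1) `^ s); last first.
    by rewrite -powRrM mulVf ?lt0r_neq0 // powRr1.
  by apply: gt0_ltr_powR; rewrite ?nnegrE ?powR_ge0 ?(ltW t_gt0).
(* Each endpoint moves by less than half of t0 - (b - a), so the new length stays below [t0]. *)
have [r1 /[!in_itv]/= /andP[r1l r1u]] : exists r1, ratr r1 \in `]a - (t0 - (b - a)) / 2, a[.
  by apply: rat_in_itvoo; lra.
have [r2 /[!in_itv]/= /andP[r2l r2u]] : exists r2, ratr r2 \in `]b, b + (t0 - (b - a)) / 2[.
  by apply: rat_in_itvoo; lra.
have sub : QI I (b - a) `<=` open_box (rat_interval (r1, r2)).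
  move=> -[x y] [/= /Isub /=]; rewrite in_itv /= => /andP[ax xb] [y0 yl].
  split => /=; first by rewrite in_itv /=; apply/andP; split; lra.
  by split => //; lra.
exists (r1, r2); last exact: sub.
have r12 : (ratr r1 : R) < ratr r2 by lra.
split => //=; apply: lt_le_trans (ht (ratr r2 - ratr r1) _ _) _; [lra|lra|].
rewrite lee_wpmul2l ?lee_fin ?powR_ge0 //; apply: subset_intV => //.
- exact: measurable_QI Iab.
- exact: measurable_open_box.
- apply: measurable_fun_EFin_abs; apply: measurable_funS mf.
    exact: measurable_Hplane.
  exact: QI_Hplane.
Qed.

(** The empty box of [None] pads the enumeration of good rational intervals to a sequence indexed by
    all naturals. *)
Definition obox (o : option (R * R)) : set (plane R) :=
  if o is Some J then open_box J else set0.

Lemma Mfrac_superlevel_seq : exists oJ : nat -> option (R * R),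
  (forall n J, oJ n = Some J -> good_interval J) /\
  [set z | Hplane z /\ (lambda%:E < Mfrac al ga f z)%E] = \bigcup_n obox (oJ n).
Proof.
have [pkl [unpk pkK]] : exists (pkl : rat * rat -> nat) (unpk : nat -> option (rat * rat)),
    pcancel pkl unpk by exists pickle, unpickle; exact: pickleK.
exists (fun n => if unpk n is Some r then
  if `[< good_interval (rat_interval r) >] then Some (rat_interval r) else None
  else None); split.
  by move=> n J; case: (unpk n) => [r|] //; case: asboolP => // gr [<-].
rewrite Mfrac_superlevelE; apply/seteqP; split => [z [r gr zr]|z [n _]].
  by exists (pkl r) => //; rewrite pkK; case: asboolP.
case: (unpk n) => [r|] //; case: asboolP => // gr zr.
by exists r.
Qed.

Lemma measurable_obox (oJ : nat -> option (R * R)) n :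
  (forall n J, oJ n = Some J -> good_interval J) -> measurable (obox (oJ n)).
Proof.
move=> /(_ n); case: (oJ n) => [J|] //= /(_ _ erefl)[ltJ _].
exact: measurable_open_box.
Qed.

(** Serves the converse direction, where monotonicity of [mu] compares a box with this set. *)
Lemma measurable_Mfrac_superlevel : measurable
  ([set z | Hplane z /\ (lambda%:E < Mfrac al ga f z)%E] : set (plane R)).
Proof.
have [oJ [oP ->]] := Mfrac_superlevel_seq.
by apply: bigcup_measurable => n _; exact: measurable_obox.
Qed.

(** Continuity of [mu] from below along the finite unions [G n], each of which obeys the same bound
    by [mu_boxes_le]. *)
Lemma mu_Mfrac_superlevel_le :
  (mu [set z | Hplane z /\ (lambda%:E < Mfrac al ga f z)%E] <=
    C%:E * epow (intV al (@Hplane R) g) (q / p))%E.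
Proof.
have [oJ [oP ->]] := Mfrac_superlevel_seq.
pose F n := obox (oJ n).
have mF n : measurable (F n) by exact: measurable_obox.
pose G n := \big[setU/set0]_(i < n.+1) F i.
have -> : \bigcup_n F n = \bigcup_n G n by rewrite /G bigcup_bigsetU_bigcup.
have mG n : measurable (G n : set (R * R)) by apply: bigsetU_measurable => i _; exact: mF.
have ndG : {homo G : n m / (n <= m)%N >-> (n <= m)%O}.
  by move=> n m nm; apply/subsetPset; exact: subset_bigsetU.
have mUG : measurable (\bigcup_n G n : set (R * R)) by exact: bigcup_measurable.
have cvG := nondecreasing_cvg_mu mG mUG ndG (mu := mu).
rewrite -(cvg_lim _ cvG) //; apply: lime_le; first by apply/cvg_ex; eexists; exact: cvG.
apply: nearW => n /=.
have -> : G n = \big[setU/set0]_(J <- pmap oJ (iota 0 n.+1)) open_box J.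
  rewrite /G -(big_mkord xpredT F) /index_iota subn0.
  elim: (iota 0 n.+1) => [|i l IH]; first by rewrite !big_nil.
  by rewrite big_cons IH /= /F; case: (oJ i) => [J|] /=; rewrite ?big_cons ?set0U.
apply: mu_boxes_le => J; rewrite mem_pmap => /mapP[i _ /esym].
exact: oP.
Qed.

End WeakType.

(** * Test functions *)

Section TestFunctions.
Context {R : realType}.
Implicit Types (al ga p q : R) (E Q : set (plane R)) (f w : plane R -> R).

(** Bounded with support in a box, hence locally integrable and admissible in (c), and also in (a)
    once the weighted integral is finite. *)
Definition test_function Q f := [/\ measurable_fun setT f,
  (exists M, forall z, 0 <= f z <= M) & forall z, ~ Q z -> f z = 0].

(** The common consequence of (a) and (c). The weighted integral is assumed finite because (a)
    speaks only of such functions. *)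
Definition test_bound al ga p q w (mu : set (R * R) -> \bar R) (K : R) :=
  forall (I : set R) (a b : R) f, interval_ab I a b ->
    let Q := QI I (b - a) in
    test_function Q f ->
    (intV al Q (fun z => (`|f z| `^ p * w z)%:E) < +oo)%E ->
    (epow (((b - a) `^ (- (2 + al - ga)))%:E * intV al Q (fun z => `|f z|%:E)) q *
       mu Q
     <= K%:E * epow (intV al Q (fun z => (`|f z| `^ p * w z)%:E)) (q / p))%E.

Lemma intV_test_lty al (I : set R) (a b : R) f : -1 < al -> interval_ab I a b ->
  test_function (QI I (b - a)) f ->
  (intV al (QI I (b - a)) (fun z => `|f z|%:E) < +oo)%E.
Proof.
move=> al1 Iab [mf [M fM] _].
have mQ := measurable_QI (b - a) Iab.
have M0 : 0 <= M by have /andP[] := fM (0, 0); exact: le_trans.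
apply: (@le_lt_trans _ _ (M%:E * Vol al (QI I (b - a)))%E).
  rewrite /Vol -intVZ //; apply: le_intV => //.
  - by apply: measurable_fun_EFin_abs; exact: measurable_funTS.
  - by move=> z _; have /andP[f0 fm] := fM z; rewrite mule1 lee_fin ger0_norm.
by rewrite (Vol_QI al1 Iab) -EFinM ltry.
Qed.

Lemma test_function_loc_integrable (I : set R) (a b : R) f : interval_ab I a b ->
  test_function (QI I (b - a)) f -> loc_integrable_H f.
Proof.
move=> Iab [mf [M fM] f0]; split; first exact: measurable_funTS mf.
move=> S _ _.
have mQ := measurable_QI (b - a) Iab.
have M0 : 0 <= M by have /andP[] := fM (0, 0); exact: le_trans.
have mQM : measurable_fun setT (fun z : plane R => (M * \1_(QI I (b - a)) z)%:E).
  by apply/measurable_EFinP; apply: measurable_funM => //; exact: measurable_indic.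
apply: (@le_lt_trans _ _ (\int[@leb2 R]_z (M * \1_(QI I (b - a)) z)%:E)%E); last first.
  under eq_integral do rewrite EFinM.
  rewrite ge0_integralZl //; last by apply/measurable_EFinP; exact: measurable_indic.
  rewrite integral_indic // setIT.
  rewrite [X in (M%:E * X)%E](_ : _ = ((b - a) ^+ 2)%:E); last exact: leb2_QI.
  by rewrite -EFinM ltry.
have fS0 z : (0 <= ((fun z => `|f z|%:E) \_ S) z)%E by apply: erestrict_ge0 => ? _; rewrite lee_fin.
(* The integrals are compared through simple functions: those below the first integrand are below
   the second. *)
rewrite integral_mkcond ge0_integralTE //.
rewrite ge0_integralTE; last by move=> z; rewrite lee_fin mulr_ge0.
apply: le_ereal_sup => _ [h /= hle <-]; exists h => // z.
apply: le_trans (hle z) _; rewrite patchE; case: ifP => _; last by rewrite lee_fin mulr_ge0.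
rewrite lee_fin indicE; case: (asboolP (QI I (b - a) z)) => Qz.
  by have /andP[f0' fm] := fM z; rewrite mem_set // mulr1 ger0_norm.
by rewrite f0 // normr0 mulr_ge0.
Qed.

Lemma test_function_powR p Q f : p != 0 -> test_function Q f ->
  forall z, ~ Q z -> `|f z| `^ p = 0.
Proof. by move=> p0 [_ _ f0] z /f0 ->; rewrite normr0 powR0. Qed.

(** With [r] the normalised integral of [f] over the box, the maximal function is at least [r] on
    all of [Q]. Since (a) has a strict inequality, it is used with lambda = r / 2, whence the factor
    2^q. *)
Lemma condA_test al ga p q w (mu : {measure set (R * R) -> \bar R}) (C1 : R) :
  1 <= p -> p <= q -> -1 < al -> 0 < 2 + al - ga -> 0 < C1 ->
  measurable_fun (@Hplane R) w -> (forall z, Hplane z -> 0 <= w z) ->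
  (forall (f : R * R -> R) (lambda : R),
    measurable_fun (@Hplane R) f ->
    (intV al (@Hplane R) (fun z => (`|f z| `^ p * w z)%:E) < +oo)%E ->
    0 < lambda ->
    (mu [set z | Hplane z /\ (lambda%:E < Mfrac al ga f z)%E]
     <= (C1 / lambda `^ q)%R%:E *
        epow (intV al (@Hplane R) (fun z => (`|f z| `^ p * w z)%:E))
             (q / p)%R)%E) ->
  test_bound al ga p q w mu (2 `^ q * C1).
Proof.
move=> p1 pq al1 s0 C10 mw w0 A I a b f Iab Q tf Xlty.
have p_gt0 : 0 < p by lra.
have q_gt0 : 0 < q by lra.
have [ab _] := Iab; have l0 : 0 < b - a by rewrite subr_gt0.
have mQ : measurable Q := measurable_QI (b - a) Iab.
have QH : Q `<=` @Hplane R by exact: QI_Hplane.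
have [mf _ f0] := tf.
have mfH : measurable_fun (@Hplane R : set (plane R)) f by exact: measurable_funTS mf.
have XE : intV al (@Hplane R) (fun z => (`|f z| `^ p * w z)%:E) =
    intV al Q (fun z => (`|f z| `^ p * w z)%:E).
  rewrite /intV [LHS]integral_mkcond [RHS]integral_mkcond; apply: eq_integral => z _.
  rewrite !patchE; case: (asboolP (Q z)) => Qz.
    by rewrite !mem_set //; exact: QH.
  rewrite [z \in Q]memNset //; case: ifP => // _.
  by rewrite (test_function_powR (lt0r_neq0 p_gt0) tf Qz) mul0r mul0e.
have X0 : (0 <= intV al Q (fun z => (`|f z| `^ p * w z)%:E))%E.
  by apply: intV_ge0 => z Qz; rewrite lee_fin mulr_ge0 ?powR_ge0 // w0 //; exact: QH.
have := intV_test_lty al1 Iab tf; rewrite -/Q.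
have : (0 <= intV al Q (fun z => `|f z|%:E))%E by apply: intV_ge0 => z _; rewrite lee_fin.
case AE : (intV al Q (fun z => `|f z|%:E)) => [N| |] // + _; rewrite lee_fin => N0.
rewrite -EFinM; set r := _ * N.
have r0 : 0 <= r by rewrite mulr_ge0 ?powR_ge0.
move: r0; rewrite le0r => /orP[/eqP ->|r0].
  rewrite epow_fin // powR0 ?lt0r_neq0 // mul0e mule_ge0 ?epow_ge0 // lee_fin.
  by rewrite mulr_ge0 ?powR_ge0 ?ltW.
have r2 : 0 < r / 2 by rewrite divr_gt0.
have := A f (r / 2) mfH; rewrite XE => /(_ Xlty r2) bnd.
have mS := measurable_Mfrac_superlevel s0 mfH r2.
have QS : Q `<=` [set z | Hplane z /\ ((r / 2)%:E < Mfrac al ga f z)%E].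
  move=> z Qz; split; first exact: QH.
  apply: (@lt_le_trans _ _ r%:E); first by rewrite lte_fin gtr_pMr // invf_lt1 ?ltr1n.
  apply: ereal_sup_ubound => /=; exists I, a, b; split => //; split => //.
  by rewrite -/Q AE -EFinM.
have muQ : (mu Q <= (C1 / (r / 2) `^ q)%:E *
    epow (intV al Q (fun z => (`|f z| `^ p * w z)%:E)) (q / p))%E.
  apply: le_trans bnd; apply: le_measure; rewrite ?inE //.
rewrite epow_pos //.
have r2q : 0 < (r / 2) `^ q by rewrite powR_gt0.
rewrite (_ : r `^ q = 2 `^ q * (r / 2) `^ q); last first.
  by rewrite -powRM ?(ltW r2) // mulrC divfK.
rewrite !EFinM -!muleA lee_wpmul2l ?lee_fin ?powR_ge0 //.
apply: le_trans (lee_wpmul2l _ muQ) _; first by rewrite lee_fin ltW.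
by rewrite muleA -EFinM mulrCA mulfV ?lt0r_neq0 // mulr1.
Qed.

(** Only the normalisation changes, from volume to side length. *)
Lemma condC_test al ga p q w (mu : {measure set (R * R) -> \bar R}) (C3 : R) :
  1 <= p -> p <= q -> -1 < al -> 0 < 2 + al - ga -> 0 < C3 ->
  (forall (f : R * R -> R) (I : set R) (a b : R),
    loc_integrable_H f -> interval_ab I a b ->
    let Q := QI I (b - a) in
    (epow (epow (Vol al Q) (- (1 - ga / (2 + al))) *
           intV al Q (fun z => `|f z|%:E)) q * mu Q
     <= C3%:E *
        epow (intV al Q (fun z => (`|f z| `^ p * w z)%:E)) (q / p)%R)%E) ->
  exists K, 0 < K /\ test_bound al ga p q w mu K.
Proof.
move=> p1 pq al1 s0 C30 C; have al0 : 0 < 1 + al by lra.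
have p_gt0 : 0 < p by lra.
have q_gt0 : 0 < q by lra.
set d := 1 - ga / (2 + al) in C; set c := (1 + al) `^ (- d).
have c0 : 0 < c by rewrite powR_gt0.
exists (c `^ q * C3); have K0 : 0 < c `^ q * C3 by rewrite mulr_gt0 ?powR_gt0.
split => // I a b f Iab Q tf _.
have [ab _] := Iab; have l0 : 0 < b - a by rewrite subr_gt0.
have := C f I a b (test_function_loc_integrable Iab tf) Iab; rewrite /= -/Q.
rewrite [Vol al Q](Vol_QI al1 Iab) epow_pos; last by rewrite divr_gt0 ?powR_gt0.
rewrite powR_side_Vol // -/d -/c; set V := _ `^ (- d) => bnd.
have := intV_test_lty al1 Iab tf; rewrite -/Q.
have : (0 <= intV al Q (fun z => `|f z|%:E))%E by apply: intV_ge0 => z _; rewrite lee_fin.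
case: (intV al Q (fun z => `|f z|%:E)) bnd => [N| |] // bnd + _; rewrite lee_fin => N0.
have V0 : 0 <= V by rewrite powR_ge0.
move: bnd; rewrite -!EFinM !epow_fin ?mulr_ge0 ?(ltW c0) // => bnd.
rewrite -mulrA powRM ?mulr_ge0 ?(ltW c0) // !EFinM -!muleA.
by rewrite lee_wpmul2l ?lee_fin ?powR_ge0.
Qed.

End TestFunctions.

(** * From test functions back to condition (b), and the box form of (c) *)

Section TestBound.
Context {R : realType}.
Implicit Types (al ga p q : R) (E Q : set (plane R)) (f w : plane R -> R).

Lemma cvg_mine_natr (x : \bar R) : (0 <= x)%E ->
  (mine x n%:R%:E) @[n --> \oo] --> x.
Proof.
case: x => [x| |] // x0; last first.
  under eq_fun do rewrite minye.
  by apply/cvgenyP.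
apply: cvg_near_cst; exists (Num.bound x) => //= n xn.
apply/min_idPl; rewrite lee_fin (le_trans (ltW (archi_boundP _))) ?ler_nat //.
Qed.

(** Monotone convergence of the truncations, which is how bounded test functions reach the unbounded
    dual weight. *)
Lemma intV_truncation_le al Q (g : plane R -> \bar R) (B : \bar R) :
  measurable Q -> measurable_fun Q g -> (forall z, Q z -> (0 <= g z)%E) ->
  (forall n : nat, (intV al Q (fun z => mine (g z) n%:R%:E) <= B)%E) ->
  (intV al Q g <= B)%E.
Proof.
move=> mQ mg g0 gB.
pose h (n : nat) (z : plane R) := (mine (g z) n%:R%:E * (z.2 `^ al)%:E)%E.
have mh n : measurable_fun Q (h n).
  by apply: measurable_yweight; apply: measurable_mine => //; exact: measurable_cst.
have h0 n z : Q z -> (0 <= h n z)%E.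
  by move=> Qz; rewrite /h mule_ge0 ?lee_fin ?powR_ge0 // le_min g0 //= lee_fin.
have ndh z : Q z -> {homo h^~ z : n m / (n <= m)%N >-> (n <= m)%E}.
  move=> Qz n m nm; rewrite /h lee_wpmul2r ?lee_fin ?powR_ge0 //.
  by rewrite le_min ge_min lexx /= ge_min lee_fin ler_nat nm orbT.
have -> : intV al Q g = (\int[@leb2 R]_(z in Q) limn (h^~ z))%E.
  apply: eq_integral => z /[!inE] Qz; apply/esym/cvg_lim => //.
  by apply: cvgeZr => //; apply: cvg_mine_natr; exact: g0.
rewrite monotone_convergence //; apply: lime_le.
  by apply: ereal_nondecreasing_is_cvgn => n m nm; apply: ge0_le_integral => //;
    [move=> z; exact: h0|move=> z Qz; exact: ndh].
by apply: nearW => n; exact: gB.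
Qed.

(** A test function with positive integral over [Q] forces [mu Q] to be finite, after which the
    bound is one between reals, with the side length traded for the volume. *)
Lemma test_bound_fin al ga p q w (mu : {measure set (R * R) -> \bar R}) (K : R)
    (I : set R) (a b : R) f (A D : R) :
  1 <= p -> p <= q -> -1 < al -> 0 < K -> (forall z, Hplane z -> 0 <= w z) ->
  test_bound al ga p q w mu K -> interval_ab I a b ->
  let Q := QI I (b - a) in
  let d := 1 - ga / (2 + al) in
  test_function Q f ->
  intV al Q (fun z => `|f z|%:E) = A%:E -> 0 < A ->
  (intV al Q (fun z => (`|f z| `^ p * w z)%:E) <= D%:E)%E ->
  exists m, mu Q = m%:E /\
    fine (Vol al Q) `^ (- (d * q)) * A `^ q * m <= K / ((1 + al) `^ (- d)) `^ q * D `^ (q / p).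
Proof.
move=> p1 pq al1 K0 w0 tb Iab Q d tf AE A0 XD.
have al0 : 0 < 1 + al by lra.
have p_gt0 : 0 < p by lra.
have q_gt0 : 0 < q by lra.
have [ab _] := Iab; have l0 : 0 < b - a by rewrite subr_gt0.
have QH : Q `<=` @Hplane R by exact: QI_Hplane.
have X0 : (0 <= intV al Q (fun z => (`|f z| `^ p * w z)%:E))%E.
  by apply: intV_ge0 => z Qz; rewrite lee_fin mulr_ge0 ?powR_ge0 // w0 //; exact: QH.
have D0 : 0 <= D by rewrite -lee_fin (le_trans X0).
have := tb I a b f Iab tf (le_lt_trans XD (ltry _)).
rewrite -/Q AE => le1.
have {le1} : (epow (((b - a) `^ (- (2 + al - ga)))%:E * A%:E) q * mu Q <= (K * D `^ (q / p))%:E)%E.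
  apply: le_trans le1 _; rewrite EFinM lee_wpmul2l ?lee_fin ?(ltW K0) //.
  by rewrite -epow_fin ?divr_gt0 //; apply: le_epow => //; rewrite divr_gt0.
rewrite powR_side_Vol // -/d [Vol al Q](Vol_QI al1 Iab) [fine _]/=.
set c := (1 + al) `^ (- d); set V := _ / (1 + al).
have V0 : 0 < V by rewrite divr_gt0 ?powR_gt0.
have c0 : 0 < c by rewrite powR_gt0.
clearbody V; rewrite -EFinM epow_pos; last by rewrite !mulr_gt0 ?powR_gt0.
have k0 : 0 < (c * V `^ (- d) * A) `^ q by rewrite powR_gt0 // !mulr_gt0 ?powR_gt0.
have m0 : (0 <= mu Q)%E := measure_ge0 mu Q.
case: (mu Q) m0 => [m| |] // m0; last by rewrite gt0_muley ?lte_fin.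
rewrite -EFinM lee_fin => le2; exists m; split => //.
have cq : 0 < c `^ q by rewrite powR_gt0.
rewrite [leRHS]mulrAC ler_pdivlMr //; apply: le_trans le2.
rewrite !powRM ?mulr_ge0 ?powR_ge0 ?(ltW A0) ?(ltW c0) // -[in leRHS]powRrM mulNr.
by rewrite le_eqVlt; apply/orP; left; apply/eqP; ring.
Qed.

(** From u <= v^(1 - p') follows u^(p - 1) <= 1 / v, hence u^p v <= u. For v = 0 the left side is
    0. *)
Lemma truncated_dual_le (v n p : R) : 1 < p -> 0 <= v -> 0 <= n ->
  let u := fine (mine (epow v%:E (1 - p / (p - 1))) n%:E) in
  `|u| `^ p * v <= u.
Proof.
move=> p1 v0 n0; cbv zeta; set u := fine _.
have r_lt0 : 1 - p / (p - 1) < 0 by rewrite conj_exponentB1 // oppr_lt0 invr_gt0 subr_gt0.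
have u0 : 0 <= u by rewrite fine_ge0 // le_min epow_ge0 lee_fin.
move: v0; rewrite le0r => /orP[/eqP ->|v0]; first by rewrite mulr0.
rewrite ger0_norm // -(mulr_powRB1 u0) ?(lt_trans ltr01) // -mulrA ler_piMr //.
rewrite -ler_pdivlMr // mul1r -(powR_conj_inv v0 p1).
apply: ge0_ler_powR; rewrite ?nnegrE ?powR_ge0 ?subr_ge0 ?(ltW p1) //.
by rewrite /u epow_pos // -EFin_min /= ge_min lexx.
Qed.

(** For p > 1 the truncated dual weight lets one number [A] bound both integrals in
    [test_bound_fin], and A^q / A^(q/p) = A^(q/p') is what (b) contains. For p = 1 the indicator of
    {w < t} is tested with [t] above the essential infimum. *)
Lemma test_condB al ga p q w (mu : {measure set (R * R) -> \bar R}) (K : R) :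
  1 <= p -> p <= q -> -1 < al -> 0 < K ->
  measurable_fun (@Hplane R) w -> (forall z, Hplane z -> 0 <= w z) ->
  test_bound al ga p q w mu K ->
  let p' := p / (p - 1) in
  exists C2 : R, 0 < C2 /\
  (forall (I : set R) (a b : R), interval_ab I a b ->
    let Q := QI I (b - a) in
    (epow (Vol al Q) (q * (ga / (2 + al) - p^-1))%R *
     (if (1 < p)%R then
        epow (((fine (Vol al Q))^-1)%R%:E *
              intV al Q (fun z => epow (w z)%:E (1 - p')%R)) (q / p')%R
      else epow (essinf_on Q w) (- q)%R) * mu Q <= C2%:E)%E).
Proof.
move=> p1 pq al1 K0 mw w0 tb p'.
have al0 : 0 < 1 + al by lra.
have p_gt0 : 0 < p by lra.
have q_gt0 : 0 < q by lra.
set d := 1 - ga / (2 + al); set c := ((1 + al) `^ (- d)) `^ q.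
have c0 : 0 < c by rewrite !powR_gt0.
have Kc0 : 0 < K / c by rewrite divr_gt0.
(* The factor 2^q serves the case p = 1, where [t] is twice the essential infimum; for p > 1 it only
   enlarges the constant. *)
exists (K / c * 2 `^ q); split; first by rewrite mulr_gt0 ?powR_gt0.
move=> I a b Iab; cbv zeta; set Q := QI I (b - a).
have [ab _] := Iab; have l0 : 0 < b - a by rewrite subr_gt0.
have mQ : measurable (Q : set (plane R)) by exact: measurable_QI Iab.
have QH : Q `<=` @Hplane R by exact: QI_Hplane.
have mwQ := measurable_funS (@measurable_Hplane R) QH mw.
have Q0 : (0 < @leb2 R Q)%E by rewrite leb2_QI // lte_fin exprn_gt0.
have VE := Vol_QI al1 Iab; rewrite -/Q in VE.
have tbf f A D := @test_bound_fin al ga p q w mu K I a b f A D p1 pq al1 K0 w0 tb Iab.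
rewrite /= -/Q VE [fine _]/= -/d -/c in tbf; rewrite VE.
set V := _ / (1 + al) in tbf VE *; have V0 : 0 < V by rewrite divr_gt0 ?powR_gt0.
clearbody V; rewrite epow_pos // [fine _]/=.
(* A box of measure zero satisfies the bound even if another factor is infinite, because 0 times
   infinity is 0. *)
have [->|mn0] := eqVneq (mu Q) 0%E.
  by rewrite mule0 lee_fin mulr_ge0 ?powR_ge0 // ltW.
have m_gt0 : (0 < mu Q)%E by rewrite lt0e mn0 measure_ge0.
have Vd0 : 0 < V `^ (- (d * q)) by rewrite powR_gt0.
case: ifPn => [p_gt1|]; last first.
  rewrite -leNgt => p_le1; have {p_le1} pE : p = 1 by apply/eqP; rewrite eq_le p1 p_le1.
  have ess_bound (t : R) : 0 < t -> (essinf_on Q w < t%:E)%E ->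
      exists m, [/\ mu Q = m%:E, 0 < m & V `^ (- (d * q)) * m <= K / c * t `^ q].
    move=> t0 et.
    pose E : set (plane R) := Q `&` [set z | ((w z)%:E < t%:E)%E].
    have mE : measurable E by exact: measurable_sublevel.
    have EQ : E `<=` Q by move=> z [].
    have EH : E `<=` @Hplane R by exact: subset_trans QH.
    have E0 : (0 < @leb2 R E)%E.
      (* Were [E] null, [t] would be an admissible level and could not exceed the essential
         infimum. *)
      rewrite lt0e measure_ge0 andbT; apply/eqP => E0; move: et; rewrite ltNge => /negP; apply.
      exact: ereal_sup_ubound.
    pose f : plane R -> R := \1_E.
    have tf : test_function Q f.
      split; first by exact: measurable_indic.
        by exists 1 => z; rewrite /f indicE ler0n lern1 leq_b1.
      by move=> z nQz; rewrite /f indicE memNset // => /EQ.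
    have f01 z : `|f z| = (z \in E)%:R by rewrite /f indicE ger0_norm.
    have fE (g : plane R -> \bar R) :
        intV al Q (fun z => `|f z|%:E * g z)%E = intV al E g.
      rewrite /intV [LHS]integral_mkcond [RHS]integral_mkcond; apply: eq_integral => z _.
      rewrite !patchE f01; case: (asboolP (E z)) => Ez.
        by rewrite !mem_set //; [rewrite mul1e|exact: EQ].
      by rewrite [z \in E]memNset // mul0e mul0e; case: ifP.
    have := intV_test_lty al1 Iab tf; rewrite -/Q.
    have : (0 < intV al Q (fun z => `|f z|%:E))%E.
      rewrite (_ : intV _ _ _ = intV al E (fun=> 1%E)); last first.
        by rewrite -fE; apply: eq_intV => z _; rewrite mule1.
      exact: intV_gt0.
    case AE : (intV al Q _) => [A| |] //; rewrite lte_fin => A0 _.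
    have mfQ : measurable_fun Q f by have [mf _ _] := tf; exact: measurable_funTS.
    (* As [w] is below [t] on [E], [test_bound_fin] applies with D = t A; the factor A^q then
       cancels. *)
    have XD : (intV al Q (fun z => (`|f z| `^ p * w z)%:E) <= (t * A)%:E)%E.
      rewrite EFinM -AE -intVZ //; last 2 first.
      - exact: measurable_fun_EFin_abs.
      - exact: ltW.
      apply: le_intV => //.
      - exact: measurable_fun_powRM.
      - by apply: emeasurable_funM => //; exact: measurable_fun_EFin_abs.
      - by move=> z Qz; rewrite lee_fin mulr_ge0 ?powR_ge0 // w0 //; exact: QH.
      move=> z Qz; rewrite -EFinM lee_fin pE powRr1 // f01.
      case: (asboolP (E z)) => Ez; last by rewrite memNset // mul0r mulr0.
      by rewrite mem_set // mul1r mulr1; case: Ez => _ /=; rewrite lte_fin => /ltW.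
    have [m [mE' le2]] := tbf f A (t * A) tf AE A0 XD.
    exists m; split => //; first by rewrite -lte_fin -mE'.
    rewrite -(ler_pM2l (_ : 0 < A `^ q)) ?powR_gt0 // mulrA [A `^ q * _]mulrC.
    apply: le_trans le2 _; rewrite pE divr1 powRM ?(ltW t0) ?(ltW A0) //.
    by rewrite le_eqVlt; apply/orP; left; apply/eqP; ring.
  have := essinf_on_lty mQ mwQ Q0; have : (0 <= essinf_on Q w)%E by apply: essinf_on_ge0 => z /QH/w0.
  case Ee : (essinf_on Q w) => [e| |] // + _; rewrite lee_fin le0r => /orP[/eqP e0|e0].
    (* A zero essential infimum would allow arbitrarily small [t], although [mu Q] is positive. *)
    exfalso.
    have h (t : R) : 0 < t -> exists m, [/\ mu Q = m%:E, 0 < m & V `^ (- (d * q)) * m <= K / c * t `^ q].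
      by move=> t0; apply: ess_bound => //; rewrite Ee e0 lte_fin.
    have [m [mE m0 _]] := h 1 ltr01.
    (* With t = y^(1/q) the right-hand side of [h] becomes half of its positive left-hand side. *)
    pose y := V `^ (- (d * q)) * m / (2 * (K / c)).
    have y0 : 0 < y by rewrite divr_gt0 // mulr_gt0.
    have [m' [mE' _]] := h (y `^ q^-1) (powR_gt0 _ y0).
    move: mE'; rewrite mE => -[<-].
    rewrite -powRrM mulVf ?lt0r_neq0 // powRr1 ?(ltW y0) // /y.
    have z0 : 0 < V `^ (- (d * q)) * m by rewrite mulr_gt0.
    rewrite (_ : K / c * _ = V `^ (- (d * q)) * m / 2); first by lra.
    by field; rewrite !lt0r_neq0.
  have e2 : (essinf_on Q w < (e * 2)%:E)%E by rewrite Ee lte_fin ltr_pMr // ltr1n.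
  have [m [-> m0 le2]] := ess_bound _ (mulr_gt0 e0 (ltr0n _ 2)) e2.
  rewrite epow_pos // -!EFinM lee_fin pE invr1.
  rewrite (_ : q * _ = - (d * q)); last by rewrite /d; field; rewrite lt0r_neq0 //; lra.
  rewrite mulrAC powRN ler_pdivrMr ?powR_gt0 //; apply: le_trans le2 _.
  by rewrite powRM ?(ltW e0) // [e `^ q * _]mulrC mulrA.
have p'_gt0 : 0 < p' by rewrite divr_gt0 // subr_gt0.
have qp'_gt0 : 0 < q / p' by exact: divr_gt0.
pose g (z : plane R) := epow (w z)%:E (1 - p').
have mg : measurable_fun Q g by exact: measurable_fun_epow.
have r_lt0 : 1 - p' < 0 by rewrite /p' conj_exponentB1 // oppr_lt0 invr_gt0 subr_gt0.
have g_gt0 z : Q z -> (0 < g z)%E.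
  move=> /QH/w0; rewrite le0r => /orP[/eqP wz|wz]; last by rewrite /g epow_gt0 ?lte_fin ?ltry.
  by rewrite /g wz epow0_neg ?ltry.
(* The level n.+1 is positive, so the truncation is positive on [Q] and A > 0. *)
have trunc_bound (n : nat) : exists m A : R, [/\ mu Q = m%:E, 0 < A,
    intV al Q (fun z => mine (g z) n.+1%:R%:E) = A%:E &
    V `^ (- (d * q)) * A `^ (q / p') * m <= K / c].
  pose f : plane R -> R := (fun z => fine (mine (g z) n.+1%:R%:E)) \_ Q.
  have fQ z : Q z -> (f z)%:E = mine (g z) n.+1%:R%:E.
    move=> Qz; rewrite /f patchE mem_set // fineK //.
    rewrite ge0_fin_numE ?gt_min ?ltry ?orbT // le_min (ltW (g_gt0 z Qz)) /= lee_fin //.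
  have f0 z : 0 <= f z.
    rewrite /f patchE; case: ifP => _; last exact: lexx.
    by rewrite fine_ge0 // le_min /g epow_ge0 lee_fin ler0n.
  have tf : test_function Q f.
    split.
    - apply/(measurable_restrictT _ mQ).
      apply: (@measurableT_comp _ _ _ _ _ _ (fine : \bar R -> R)); first exact: fine_measurable.
      by apply: measurable_mine => //; exact: measurable_cst.
    - exists n.+1%:R => z; rewrite f0 /=; case: (asboolP (Q z)) => Qz.
        by rewrite -lee_fin fQ // ge_min lexx orbT.
      by rewrite /f patchE memNset.
    - by move=> z Qz; rewrite /f patchE memNset.
  have := intV_test_lty al1 Iab tf; rewrite -/Q.
  have IE : intV al Q (fun z => `|f z|%:E) = intV al Q (fun z => mine (g z) n.+1%:R%:E).
    by apply: eq_intV => z Qz; rewrite ger0_norm // fQ.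
  have : (0 < intV al Q (fun z => `|f z|%:E))%E.
    rewrite IE; apply: intV_gt0 => //.
      by apply: measurable_mine => //; exact: measurable_cst.
    by move=> z Qz; rewrite lt_min g_gt0 //= lte_fin.
  case AE : (intV al Q (fun z => `|f z|%:E)) => [A| |] //; rewrite lte_fin => A0 _.
  have XD : (intV al Q (fun z => (`|f z| `^ p * w z)%:E) <= A%:E)%E.
    have [mf _ _] := tf; have mfQ := measurable_funTS mf : measurable_fun Q f.
    rewrite -AE; apply: le_intV => //.
    - exact: measurable_fun_powRM.
    - exact: measurable_fun_EFin_abs.
    - by move=> z Qz; rewrite lee_fin mulr_ge0 ?powR_ge0 // w0 //; exact: QH.
    move=> z Qz; rewrite lee_fin [leRHS]ger0_norm //.
    rewrite /f patchE mem_set //; apply: truncated_dual_le => //.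
    by apply: w0; exact: QH.
  have [m [mE le2]] := tbf f A A tf AE A0 XD.
  exists m, A; split => //; first by rewrite -IE.
  rewrite -(ler_pM2l (_ : 0 < A `^ (q / p))) ?powR_gt0 // [leRHS]mulrC.
  apply: le_trans le2; rewrite mulrA [A `^ _ * _]mulrCA -powRD; last by rewrite (gt_eqF A0) implybT.
  rewrite (_ : q / p + q / p' = q) //.
  by rewrite /p'; field; rewrite !lt0r_neq0 ?subr_gt0.
have [m [_ [mE _ _ _]]] := trunc_bound 0%N.
have m0 : 0 < m by rewrite -lte_fin -mE.
(* By [trunc_bound], A^(q/p') <= T at every level, and [T] does not depend on the level. *)
pose T := K / c / (V `^ (- (d * q)) * m).
have T0 : 0 < T by rewrite divr_gt0 // mulr_gt0.
have WT : (intV al Q g <= (T `^ (q / p')^-1)%:E)%E.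
  apply: intV_truncation_le => //; first by move=> z /g_gt0/ltW.
  move=> n; have [m' [A [mE' A0 AE le2]]] := trunc_bound n.
  move: mE'; rewrite mE => -[m'E]; rewrite -m'E in le2.
  (* The truncation at [n] lies below the one at n.+1, to which [trunc_bound] applies. *)
  apply: (@le_trans _ _ (intV al Q (fun z => mine (g z) n.+1%:R%:E))).
    apply: le_intV => //.
    - by apply: measurable_mine => //; exact: measurable_cst.
    - by apply: measurable_mine => //; exact: measurable_cst.
    - by move=> z Qz; rewrite le_min (ltW (g_gt0 z Qz)) lee_fin ler0n.
    - by move=> z Qz; rewrite le_min ge_min lexx /= ge_min lee_fin ler_nat leqnSn orbT.
  rewrite AE lee_fin -[leLHS](_ : (A `^ (q / p')) `^ (q / p')^-1 = A); last first.
    by rewrite -powRrM mulfV ?lt0r_neq0 // powRr1 // ltW.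
  apply: ge0_ler_powR; rewrite ?nnegrE ?powR_ge0 ?invr_ge0 ?(ltW qp'_gt0) ?(ltW T0) //.
  by rewrite /T ler_pdivlMr ?mulr_gt0 // mulrA [A `^ _ * _]mulrC.
have : (0 < intV al Q g)%E by exact: intV_gt0.
rewrite mE; move: WT; rewrite -/g; case: (intV al Q g) => [W| |] //.
rewrite lee_fin lte_fin => WT W0.
rewrite -EFinM epow_pos ?mulr_gt0 ?invr_gt0 // -!EFinM lee_fin.
have WT' : W `^ (q / p') <= T.
  rewrite -[leRHS](_ : (T `^ (q / p')^-1) `^ (q / p') = T); last first.
    by rewrite -powRrM mulVf ?lt0r_neq0 // powRr1 // ltW.
  by apply: ge0_ler_powR; rewrite ?nnegrE ?powR_ge0 ?(ltW qp'_gt0) ?(ltW W0).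
apply: (@le_trans _ _ (K / c)); last first.
  by rewrite ler_peMr ?(ltW Kc0) // -[leLHS](powRr0 2) ler_powR ?ler1n ?(ltW q_gt0).
rewrite powRM ?invr_ge0 ?(ltW V0) ?(ltW W0) // -[V^-1]powR_inv1 ?(ltW V0) //.
rewrite -powRrM mulN1r mulrA -powRD; last by rewrite (gt_eqF V0) implybT.
rewrite (_ : q * _ + _ = - (d * q)); last first.
  by rewrite /d /p'; field; rewrite !lt0r_neq0 ?subr_gt0 //; lra.
by rewrite mulrAC mulrC -ler_pdivlMr // mulr_gt0.
Qed.

(** The box inequality with E = Q; the constant (1 + al)^d undoes the factor that [powR_side_Vol]
    introduces. *)
Lemma box_condC al ga p q w (mu : {measure set (R * R) -> \bar R}) (K : R) :
  1 <= p -> p <= q -> -1 < al -> 0 < K ->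
  box_bound al ga p q w mu K ->
  exists C3 : R, 0 < C3 /\
  (forall (f : R * R -> R) (I : set R) (a b : R),
    loc_integrable_H f -> interval_ab I a b ->
    let Q := QI I (b - a) in
    (epow (epow (Vol al Q) (- (1 - ga / (2 + al))) *
           intV al Q (fun z => `|f z|%:E)) q * mu Q
     <= C3%:E *
        epow (intV al Q (fun z => (`|f z| `^ p * w z)%:E)) (q / p)%R)%E).
Proof.
move=> p1 pq al1 K0 box.
have q_gt0 : 0 < q by lra.
have al0 : 0 < 1 + al by lra.
set d := 1 - ga / (2 + al); pose c := (1 + al) `^ d.
have c0 : 0 < c by rewrite powR_gt0.
exists (c `^ q * K); split; first by rewrite mulr_gt0 ?powR_gt0.
move=> f I a b [mf _] Iab; cbv zeta; set Q := QI I (b - a).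
have [ab _] := Iab; have l0 : 0 < b - a by rewrite subr_gt0.
have mQ : measurable (Q : set (plane R)) := measurable_QI (b - a) Iab.
have := box I a b Q f Iab mQ (@subset_refl _ _) mf.
rewrite powR_side_Vol // -/d [Vol al Q](Vol_QI al1 Iab).
set V := _ / (1 + al); have V0 : 0 < V by rewrite divr_gt0 ?powR_gt0.
rewrite epow_pos // -/Q => bnd.
have -> : V `^ (- d) = c * ((1 + al) `^ (- d) * V `^ (- d)).
  by rewrite mulrA /c [X in _ * X * _]powRN mulfV ?mul1r // lt0r_neq0 // powR_gt0.
rewrite EFinM -muleA.
have A0 : (0 <= ((1 + al) `^ (- d) * V `^ (- d))%:E * intV al Q (fun z => `|f z|%:E))%E.
  by rewrite mule_ge0 ?lee_fin ?mulr_ge0 ?powR_ge0 // intV_ge0.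
have epowM (x : \bar R) : (0 <= x)%E -> epow (c%:E * x) q = ((c `^ q)%:E * epow x q)%E.
  case: x => [x| |] // x0.
    by rewrite -EFinM !epow_fin ?mulr_ge0 ?(ltW c0) // powRM ?(ltW c0).
  by rewrite gt0_muley ?lte_fin // epow_pinfty // gt0_muley // lte_fin powR_gt0.
rewrite epowM // -[leLHS]muleA [X in (_ <= X * _)%E]EFinM -[leRHS]muleA.
by rewrite lee_wpmul2l ?lee_fin ?powR_ge0.
Qed.

End TestBound.

(** * Equivalence of the three conditions *)

Theorem theorem2p3 (R : realType) (p q alpha gamma : R)
  (w : R * R -> R) (mu : {measure set (R * R) -> \bar R}) :
  1 <= p -> p <= q -> -1 < alpha -> 0 <= gamma -> gamma < 2 + alpha ->
  weight w ->
  let p' := p / (p - 1) in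
  let condA := exists C1 : R, 0 < C1 /\
      forall (f : R * R -> R) (lambda : R),
        measurable_fun (@Hplane R) f ->
        (intV alpha (@Hplane R) (fun z => (`|f z| `^ p * w z)%:E) < +oo)%E ->
        0 < lambda ->
        (mu [set z | Hplane z /\ (lambda%:E < Mfrac alpha gamma f z)%E]
         <= (C1 / lambda `^ q)%R%:E *
            epow (intV alpha (@Hplane R) (fun z => (`|f z| `^ p * w z)%:E))
                 (q / p)%R)%E in
  let condB := exists C2 : R, 0 < C2 /\
      forall (I : set R) (a b : R), interval_ab I a b ->
        let Q := QI I (b - a) in
        (epow (Vol alpha Q) (q * (gamma / (2 + alpha) - p^-1))%R *
         (if (1 < p)%R then
            epow (((fine (Vol alpha Q))^-1)%R%:E *
                  intV alpha Q (fun z => epow (w z)%:E (1 - p')%R))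
                 (q / p')%R
          else epow (essinf_on Q w) (- q)%R) *
         mu Q <= C2%:E)%E in
  let condC := exists C3 : R, 0 < C3 /\
      forall (f : R * R -> R) (I : set R) (a b : R),
        loc_integrable_H f -> interval_ab I a b ->
        let Q := QI I (b - a) in
        (epow (epow (Vol alpha Q) (- (1 - gamma / (2 + alpha))) *
               intV alpha Q (fun z => `|f z|%:E)) q *
         mu Q
         <= C3%:E *
            epow (intV alpha Q (fun z => (`|f z| `^ p * w z)%:E)) (q / p)%R)%E in
  (condA <-> condB) /\ (condB <-> condC).
Proof.
move=> p1 pq al1 ga0 gaN [w0 [mw _]] p' condA condB condC.
have s0 : 0 < 2 + alpha - gamma by rewrite subr_gt0.
have q_gt0 : 0 < q by lra.
have p_gt0 : 0 < p by lra.
have mwP : measurable_fun (@Hplane R : set (plane R)) w := mw.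
(* Condition (b) reaches (a) and (c) through [box_bound]; both return to (b) through
   [test_bound]. *)
have BoxA K : 0 < K -> box_bound alpha gamma p q w mu K -> condA.
  move=> K0 box; exists (K * (3 `^ (2 + alpha - gamma)) `^ q); split.
    by rewrite mulr_gt0 ?powR_gt0.
  move=> f lambda mf _ l0.
  exact: (mu_Mfrac_superlevel_le p1 pq s0 K0 mwP w0 box mf l0).
have BtoBox : condB -> exists K, 0 < K /\ box_bound alpha gamma p q w mu K.
  by move=> [C2 [C20 B]]; exact: condB_box p1 pq al1 C20 mwP w0 B.
have TestB K : 0 < K -> test_bound alpha gamma p q w mu K -> condB.
  by move=> K0 tb; exact: test_condB p1 pq al1 K0 mwP w0 tb.
have AB : condA -> condB.
  move=> [C1 [C10 A]]; apply: (TestB (2 `^ q * C1)).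
    by rewrite mulr_gt0 ?powR_gt0.
  exact: condA_test p1 pq al1 s0 C10 mwP w0 A.
have BA : condB -> condA by move=> /BtoBox[K [K0 box]]; exact: BoxA K0 box.
have CB : condC -> condB.
  move=> [C3 [C30 C]].
  by have [K [K0 tb]] := condC_test p1 pq al1 s0 C30 C; exact: TestB K0 tb.
have BC : condB -> condC.
  move=> /BtoBox[K [K0 box]].
  exact: box_condC p1 pq al1 K0 box.
by split; split.
Qed.
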